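(* Let $\mathfrak C$ be a left cancellative small category. Then $\mathrm{Iso}(\bar I_l\ltimes\partial\Omega)^\circ=\bar I_l^c\ltimes\partial\Omega$ (the interior of the isotropy subgroupoid). Moreover, the following are equivalent: (i) $I_l\,\bar\ltimes\,\partial\Omega\cong\bar I_l\ltimes\partial\Omega$ is effective. (ii) $\bar I_l^c\ltimes\partial\Omega=\partial\Omega$. (iii) For all $s\in\bar I_l^c$ there exist $\varepsilon_1,\dots,\varepsilon_n\in\bar{\mathcal J}$ with $s\varepsilon_i=\varepsilon_i$ for all $1\le i\le n$ such that for all $g\in\mathcal J$ with $\emptyset\ne g\le s^{-1}s$ there exists $1\le i\le n$ with $g\varepsilon_i\ne\emptyset$.
   Context: $\mathfrak C$ denotes the set of morphisms, $\mathfrak C^0\subseteq\mathfrak C$ the identity morphisms, $\mathfrak d,\mathfrak t$ domain and target; $cd$ is defined iff $\mathfrak d(c)=\mathfrak t(d)$; left cancellative means $cx=cy\Rightarrow x=y$. Each $c\in\mathfrak C$ gives the partial bijection $\mathfrak d(c)\mathfrak C\to c\mathfrak C$, $x\mapsto cx$; $I_l$ is the smallest semigroup of partial bijections of $\mathfrak C$ containing these and closed under inverses; $\mathcal J=\{\mathrm{dom}(s):s\in I_l\}$ is its semilattice of idempotents. $\bar{\mathcal J}$ is the set of subsets $\varepsilon=e\setminus\bigcup_{i=1}^nf_i$ of $\mathfrak C$ with $e,f_1,\dots,f_n\in\mathcal J$, $f_i\subseteq e$. $\bar I_l$ is the inverse semigroup of all partial bijections $s\varepsilon$ (restriction of $s$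 to $\varepsilon$) with $s\in I_l$, $\varepsilon\in\bar{\mathcal J}$, $\varepsilon\subseteq\mathrm{dom}(s)$; its semilattice of idempotents is $\bar{\mathcal J}$. Idempotents are identified with subsets of $\mathfrak C$: products are intersections, $\le$ is inclusion, $s^{-1}s=\mathrm{dom}(s)$, $ses^{-1}=s(e\cap\mathrm{dom}(s))$, and $s\varepsilon=\varepsilon$ means $\varepsilon\subseteq\mathrm{dom}(s)$ and $s(x)=x$ for $x\in\varepsilon$. $\widehat{\mathcal J}$ is the space of non-zero multiplicative maps $\chi:\mathcal J\to\{0,1\}$ with $\chi(\emptyset)=0$ if $\emptyset\in\mathcal J$ (pointwise convergence). $\Omega\subseteq\widehat{\mathcal J}$ consists of those $\chi$ such that whenever $e=\bigcup_{i=1}^nf_i$ ($e,f_i\in\mathcal J$) and $\chi(e)=1$, then $\chi(f_i)=1$ for some $i$. For $\chi\in\Omega$, $\varepsilon=e\setminus\bigcup f_i\in\bar{\mathcal J}$, put $\chi(\varepsilon)=1$ iff $\chi(e)=1$ and all $\chi(f_i)=0$, and $\chi(\varepsilon)=0$ otherwise. $\partial\Omega\subseteq\Omega$ is the closure of the set $\Omega_{\max}$ of $\chi\in\widehat{\mathcal J}$ with $\chi^{-1}(1)$ maximal. $\bar I_l$ acts on $\Omega$ and $\partial\Omega$: $s$ maps $\{\chi(s^{-1}s)=1\}$ onto $\{\chi(ss^{-1})=1\}$ by $(s.\chi)(f)=\chi(s^{-1}fs)$. $\bar I_l\ltimes\partial\Omega$ is the groupoid of classes $[s,\chi]$ with $s\in\bar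 I_l$, $\chi\in\partial\Omega$, $\chi(s^{-1}s)=1$, where $[s,\chi]=[t,\psi]$ iff $\chi=\psi$ and $s\varepsilon=t\varepsilon$ for some $\varepsilon\in\bar{\mathcal J}$ with $\chi(\varepsilon)=1$; source $\chi$, range $s.\chi$; topology such that the sets $\{[s,\chi]:\chi(s^{-1}s)=1\}$ are open and mapped homeomorphically by the source map onto $\{\chi\in\partial\Omega:\chi(s^{-1}s)=1\}$. $I_l\,\bar\ltimes\,\partial\Omega$ is defined in the same way with $s\in I_l$ only (same equivalence relation); the inclusion $I_l\subseteq\bar I_l$ induces an isomorphism $I_l\,\bar\ltimes\,\partial\Omega\cong\bar I_l\ltimes\partial\Omega$. $\bar I_l^f:=\{s\in\bar I_l:\exists f\in\mathcal J,\ \emptyset\ne f\le s^{-1}s\}$; $\bar I_l^c:=\{s\in\bar I_l^f: e(ses^{-1})\ne\emptyset\ \forall e\in\mathcal J\text{ with }\emptyset\ne e\le s^{-1}s\}$; $\bar I_l^c\ltimes\partial\Omega:=\{[s,\chi]\in\bar I_l\ltimes\partial\Omega:s\in\bar I_l^c\}$. An étale groupoid is effective if the interior of its isotropy subgroupoid equals its unit space. *)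

(* Defs.v *)
From HB Require Import structures.
From mathcomp Require Import all_boot.
From mathcomp Require Import all_classical topology.

Set Implicit Arguments.
Unset Strict Implicit.
Unset Printing Implicit Defensive.

Local Open Scope classical_set_scope.
Local Open Scope relation_scope.
Local Open Scope quotient_scope.

(** Small categories as sets of morphisms: objects are identified with identity
    morphisms, and [mcomp c d] is only meaningful when [dom c = tgt d]. *)

HB.mixin Record isCategory (C : Type) := {
  dom : C -> C;
  tgt : C -> C;
  mcomp : C -> C -> C;
  dom_tgt : forall c, dom (tgt c) = tgt c;
  tgt_dom : forall c, tgt (dom c) = dom c;
  dom_mcomp : forall c d, dom c = tgt d -> dom (mcomp c d) = dom d;
  tgt_mcomp : forall c d, dom c = tgt d -> tgt (mcomp c d) = tgt c;
  mcomp_dom : forall c, mcomp c (dom c) = c;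
  mcomp_tgt : forall c, mcomp (tgt c) c = c;
  mcompA : forall b c d, dom b = tgt c -> dom c = tgt d ->
    mcomp b (mcomp c d) = mcomp (mcomp b c) d
}.

#[short(type="categoryType")]
HB.structure Definition Category := {C of isCategory C}.

Definition identities (C : categoryType) : set C := [set u | dom u = u].

HB.mixin Record isLeftCancellative C of isCategory C := {
  mcompI : forall c x y : C, dom c = tgt x -> dom c = tgt y ->
    mcomp c x = mcomp c y -> x = y
}.

#[short(type="lcCategoryType")]
HB.structure Definition LCCategory :=
  {C of isLeftCancellative C & isCategory C}.

HB.mixin Record isGroupoid G of isCategory G := {
  minv : G -> G;
  dom_minv : forall g, dom (minv g) = tgt g;
  tgt_minv : forall g, tgt (minv g) = dom g;
  mcomp_minvl : forall g, mcomp (minv g) g = dom g;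
  mcomp_minvr : forall g, mcomp g (minv g) = tgt g
}.

#[short(type="groupoidType")]
HB.structure Definition Groupoid := {G of isGroupoid G & isCategory G}.

(** The source map is a local homeomorphism: continuous, open and locally
    injective. *)
HB.mixin Record isEtale G of Topological G & Groupoid G := {
  minv_continuous : continuous (minv : G -> G);
  mcomp_continuous : {within [set gh : G * G | dom gh.1 = tgt gh.2],
    continuous (fun gh : G * G => mcomp gh.1 gh.2)};
  dom_continuous : continuous (dom : G -> G);
  dom_open : forall U : set G, open U -> open (dom @` U);
  dom_locally_inj : forall g : G,
    exists2 U, open_nbhs g U & {in U &, injective (dom : G -> G)}
}.

#[short(type="etaleGroupoidType")]
HB.structure Definition EtaleGroupoid :=
  {G of isEtale G & Topological G & Groupoid G}.

Definition isotropy (G : groupoidType) : set G := [set g | dom g = tgt g].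
Arguments isotropy : clear implicits.
Arguments identities : clear implicits.

Definition effective (G : etaleGroupoidType) : Prop :=
  (isotropy G)° = identities G.

(** Partial bijections are represented by their graphs: [s (x, y)] means
    [s x = y], [s.`1] is the domain, [s.`2] the range, [s^-1] the inverse and
    [s \; t] the composite "s after t". *)

Section Relations.
Context {T : Type}.
Implicit Types (s t u : set (T * T)) (A B : set T).

Definition pbij s :=
  (forall x y z, s (x, y) -> s (x, z) -> y = z) /\
  (forall x y z, s (x, z) -> s (y, z) -> x = y).

Definition img s A : set T := [set y | exists2 x, A x & s (x, y)].

Definition restr s A : set (T * T) := [set xy | A xy.1 /\ s xy].

Definition idrel A : set (T * T) := [set xy | A xy.1 /\ xy.2 = xy.1].

Arguments img _ _ _ /.
Arguments restr _ _ _ /.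
Arguments idrel _ _ /.

Lemma releqP s t : (forall x y, s (x, y) <-> t (x, y)) -> s = t.
Proof. by move=> h; apply/seteqP; split=> -[x y] /h. Qed.

Lemma seteq A B : (forall x, A x <-> B x) -> A = B.
Proof. by move=> h; apply/seteqP; split=> x /h. Qed.

Lemma pbijV s : pbij s -> pbij s^-1.
Proof. by case=> h1 h2; split=> x y z /=; [exact: h2|exact: h1]. Qed.

Lemma pbij_comp s t : pbij s -> pbij t -> pbij (s \; t).
Proof.
move=> [s1 s2] [t1 t2]; split=> x y z /= [a ta sa] [b tb sb].
  by move: sb; rewrite -(t1 _ _ _ ta tb); exact: s1.
by move: tb; rewrite -(s2 _ _ _ sa sb); exact: t2.
Qed.

Lemma pbij_restr s A : pbij s -> pbij (restr s A).
Proof.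
by case=> h1 h2; split=> x y z /= [_ h] [_]; [exact: h1 h|exact: h2 h].
Qed.

Lemma relK s : pbij s -> s^-1 \; s = idrel s.`1.
Proof.
case=> s1 s2; apply: releqP => x y; split=> /=.
  by case=> z sx sy; split; [exists z|rewrite (s2 _ _ _ sx sy)].
by case=> -[z sx] ->; exists z.
Qed.

Lemma relA s t u : s \; (t \; u) = (s \; t) \; u.
Proof.
apply: releqP => x y; split=> /=.
  by case=> z [w a b] c; exists w => //; exists z.
by case=> z a [w b c]; exists w => //; exists z.
Qed.

Lemma relVV s : s^-1^-1 = s.
Proof. by apply: releqP. Qed.

Lemma comp_idrel s A : s \; idrel A = restr s A.
Proof.
apply: releqP => x y; split=> /=; first by case=> z [Ax ->].
by case=> Ax sxy; exists x.
Qed.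

Lemma restr_dom s : restr s s.`1 = s.
Proof. by apply: releqP => x y; split=> [[]//|/= h]; split=> //; exists y. Qed.

Lemma restr_restr s A B : restr (restr s A) B = restr s (A `&` B).
Proof. by apply: releqP => x y; split=> /= [[? []]|[[]]]. Qed.

Lemma dom_restr s A : A `<=` s.`1 -> (restr s A).`1 = A.
Proof.
move=> As; apply: seteq => x; split=> /= [[y []]//|Ax].
by have [y sxy] := As _ Ax; exists y.
Qed.

Lemma dom_idrel A : (idrel A).`1 = A.
Proof. by apply: seteq => x; split=> /= [[y []]//|Ax]; exists x. Qed.

Lemma dom_comp s t : (s \; t).`1 = img t^-1 s.`1.
Proof.
apply: seteq => x; split=> /= [[y [z a b]]|[z [y a] b]].
  by exists z => //; exists y.
by exists y; exists z.
Qed.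

Lemma img_comp s t A : img (s \; t) A = img s (img t A).
Proof.
apply: seteq => y; split=> /= [[x Ax [z a b]]|[z [x Ax a] b]].
  by exists z => //; exists x.
by exists x => //; exists z.
Qed.

Lemma compV s t : (s \; t)^-1 = t^-1 \; s^-1.
Proof. by apply: releqP => x y; split=> /= -[z a b]; exists z. Qed.

Lemma img_dom s : img s^-1 (s^-1).`1 = s.`1.
Proof.
apply: seteq => x; split=> /= [[y _ sxy]|[y sxy]]; first by exists y.
by exists y => //; exists x.
Qed.

Lemma img_restrV s A B : img (restr s A)^-1 B = A `&` img s^-1 B.
Proof.
apply: seteq => x; split=> /= [[y By [Ax sxy]]|[Ax [y By sxy]]].
  by split=> //; exists y.
by exists y.
Qed.

Lemma img_idrelV A B : img (idrel A)^-1 B = A `&` B.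
Proof.
apply: seteq => x; split=> /= [[y By [Ax e]]|[Ax Bx]]; last by exists x.
by split=> //; rewrite -e.
Qed.

Lemma imgS s A B : A `<=` B -> img s A `<=` img s B.
Proof. by move=> AB y [x /AB Bx sxy]; exists x. Qed.

Lemma idrelV A : (idrel A)^-1 = idrel A.
Proof. by apply: releqP => x y; split=> /= -[h e]; rewrite ?e // -e. Qed.

Lemma pbij_idrel A : pbij (idrel A).
Proof. by split=> x y z /= [_ e] [_ e']; congruence. Qed.

End Relations.

Section InverseHulls.
Context {C : lcCategoryType}.
Implicit Types (s t : set (C * C)).

(** x |-> c x, from dom(c) C onto c C *)
Definition lmul (c : C) : set (C * C) :=
  [set xy | dom c = tgt xy.1 /\ xy.2 = mcomp c xy.1].

Inductive Il : set (C * C) -> Prop :=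
| Il_lmul c : Il (lmul c)
| Il_inv s : Il s -> Il s^-1
| Il_comp s t : Il s -> Il t -> Il (s \; t).

Definition J : set (set C) := [set e | exists2 s, Il s & e = s.`1].

(** epsilon = e minus the union of the finite family F of elements of J below e *)
Definition is_diff (eps : set C) (e : J) (F : set J) :=
  [/\ finite_set F, forall f, F f -> val f `<=` val e
    & eps = val e `\` \bigcup_(f in F) val f].

Definition Jbar : set (set C) :=
  [set eps | exists (e : J) (F : set J), is_diff eps e F].

Definition Ilbar : set (set (C * C)) :=
  [set r | exists s eps, [/\ Il s, Jbar eps, eps `<=` s.`1 & r = restr s eps]].

Definition Ilbarf : set (set (C * C)) :=
  [set s | Ilbar s /\ exists2 f : J, val f !=set0 & val f `<=` s.`1].

Definition Ilbarc : set (set (C * C)) :=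
  [set s | Ilbarf s /\ forall e : J, val e !=set0 -> val e `<=` s.`1 ->
     (val e `&` img s (val e)) !=set0].

Lemma pbij_lmul c : pbij (lmul c).
Proof.
split=> x y z; rewrite /lmul/= => -[h1 e1] [h2 e2]; first by rewrite e1 e2.
by apply: (mcompI _ _ _ h1 h2); rewrite -e1 -e2.
Qed.

Lemma pbij_Il s : Il s -> pbij s.
Proof.
elim=> [c|{}s _|{}s t _ hs _ ht]; first exact: pbij_lmul.
- exact: pbijV.
- exact: pbij_comp.
Qed.

Lemma pbij_Ilbar s : Ilbar s -> pbij s.
Proof. by case=> t [eps [/pbij_Il ht _ _ ->]]; exact: pbij_restr. Qed.

Lemma JP (e : J) : J (val e). Proof. exact: set_mem (valP e). Qed.

Definition mkJ A (h : J A) : J := exist _ A (mem_set h).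

Lemma J_inj (e f : J) : val e = val f -> e = f. Proof. exact: val_inj. Qed.

Lemma J_img s A : Il s -> J A -> J (img s A).
Proof.
move=> hs [t ht ->]; exists (t \; s^-1).
  by apply: Il_comp => //; exact: Il_inv.
by rewrite dom_comp relVV.
Qed.

Lemma J_setI A B : J A -> J B -> J (A `&` B).
Proof.
move=> [s hs ->] [t ht ->]; exists (t \; (s^-1 \; s)).
  by do !apply: Il_comp => //; exact: Il_inv.
by rewrite (relK (pbij_Il hs)) dom_comp img_idrelV.
Qed.

Definition Jand (e f : J) : J := mkJ (J_setI (JP e) (JP f)).
Definition Jimg s (hs : Il s) (e : J) : J := mkJ (J_img hs (JP e)).

Lemma is_diff0 (e : J) : is_diff (val e) e set0.
Proof. by split=> //; rewrite bigcup_set0 setD0. Qed.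

Lemma is_diffI A B e e' F F' : is_diff A e F -> is_diff B e' F' ->
  is_diff (A `&` B) (Jand e e') [set Jand (Jand e e') f | f in F `|` F'].
Proof.
move=> [fF sF ->] [fF' sF' ->]; split.
- by apply: finite_image; rewrite finite_setU.
- by move=> _ [f _ <-] x /= [].
- apply: seteq => x; split=> /=.
    move=> [[ex nF] [e'x nF']]; split=> // -[_ [f [Ff|Ff] <-] /= [_ fx]].
      by apply: nF; exists f.
    by apply: nF'; exists f.
  move=> [[ex e'x] nF]; split; split=> // -[f Ff fx]; apply: nF;
    exists (Jand (Jand e e') f); do ?[exists f => //; by [left|right]];
    by split.
Qed.

Lemma Jbar_setI A B : Jbar A -> Jbar B -> Jbar (A `&` B).
Proof.
move=> [e [F dA]] [f [G dB]].
by eexists; eexists; exact: is_diffI dA dB.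
Qed.

Lemma is_diff_img s (hs : Il s) A e F : is_diff A e F ->
  is_diff (img s A) (Jimg hs e) (Jimg hs @` F).
Proof.
move=> [fF sF ->]; have [_ inj] := pbij_Il hs; split.
- exact: finite_image.
- by move=> _ [f Ff <-]; apply: imgS; exact: sF.
- apply: seteq => y; split=> /=.
    move=> [x [ex nF] sxy]; split; first by exists x.
    move=> [_ [f Ff <-]] /= [z fz szy]; apply: nF; exists f => //.
    by rewrite (inj _ _ _ sxy szy).
  move=> [[x ex sxy] nF]; exists x => //; split=> // -[f Ff fx].
  by apply: nF; exists (Jimg hs f); [exists f|exists x].
Qed.

Lemma Jbar_img s A : Il s -> Jbar A -> Jbar (img s A).
Proof.
move=> hs [e [F dA]]; eexists; eexists; exact: (is_diff_img hs dA).
Qed.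

Lemma J_Jbar (e : J) : Jbar (val e).
Proof. by exists e, set0; exact: is_diff0. Qed.

Lemma Il_Ilbar s : Il s -> Ilbar s.
Proof.
move=> hs; exists s, s.`1; split=> //; last by rewrite restr_dom.
by apply: (J_Jbar (@mkJ s.`1 _)); exists s.
Qed.

Lemma Jbar_dom s : Ilbar s -> Jbar s.`1.
Proof. by case=> t [eps [_ he hs ->]]; rewrite dom_restr. Qed.

Lemma Ilbar_inv s : Ilbar s -> Ilbar s^-1.
Proof.
case=> t [eps [ht he te ->]]; exists t^-1, (img t eps); split.
- exact: Il_inv.
- exact: Jbar_img.
- by move=> y [x _ txy]; exists x.
- have [_ inj] := pbij_Il ht.
  apply: releqP => x y; split=> /= [[ey tyx]|[[z ez tzx] tyx]].
    by split=> //; exists y.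
  by split=> //; rewrite (inj y z x).
Qed.

Lemma Ilbar_comp s t : Ilbar s -> Ilbar t -> Ilbar (s \; t).
Proof.
move=> [s' [d [hs hd sd ->]]] [t' [e [ht he te ->]]].
exists (s' \; t'), (e `&` img t'^-1 d); split.
- exact: Il_comp.
- by apply: Jbar_setI => //; apply: Jbar_img => //; exact: Il_inv.
- move=> x [ex [y dy txy]]; have [z syz] := sd _ dy.
  by exists z; exists y.
- have [fn _] := pbij_Il ht; apply: releqP => x y; split=> /=.
    move=> [z [ex tz] [dz sz]]; split; last by exists z.
    by split=> //; exists z.
  move=> [[ex [w dw tw]] [z tz sz]]; exists z => //; split=> //.
  by rewrite (fn _ _ _ tz tw).
Qed.

Lemma Ilbar_idrel A : Jbar A -> Ilbar (idrel A).
Proof.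
move=> [e [F dA]]; have [s hs es] := JP e; exists (s^-1 \; s), A.
have sAe : A `<=` s.`1 by rewrite -es; case: dA => _ _ -> x [].
split.
- by apply: Il_comp => //; exact: Il_inv.
- by exists e, F.
- by rewrite (relK (pbij_Il hs)) dom_idrel.
- rewrite (relK (pbij_Il hs)); apply: releqP => x y.
  by split=> /= [[Ax e']|[Ax [_ e']]]; split=> //; split=> //; exact: sAe.
Qed.

End InverseHulls.
Arguments J : clear implicits.
Arguments Jbar : clear implicits.
Arguments Il : clear implicits.
Arguments Ilbar : clear implicits.
Arguments Ilbarf : clear implicits.
Arguments Ilbarc : clear implicits.

(** Maps J -> {0,1}, with the topology of pointwise convergence *)
Notation chi C := ({ptws J C -> bool}).

Section Characters.
Context {C : lcCategoryType}.
Implicit Types (x y : chi C) (e f : J C) (s t : set (C * C)).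

Definition Jhat : set (chi C) := [set x : chi C |
  [/\ exists e, x e,
      forall e f g, val g = val e `&` val f -> x g = x e && x f
    & forall e, val e = set0 -> ~~ x e]].

Definition Omega : set (chi C) := [set x : chi C | Jhat x /\
  forall e (F : set (J C)), finite_set F ->
    val e = \bigcup_(f in F) val f -> x e -> exists2 f, F f & x f].

Definition Omega_max : set (chi C) := [set x : chi C | Jhat x /\
  forall y, Jhat y -> [set e | x e] `<=` [set e | y e] -> y = x].

(** The closure is taken inside Omega. *)
Definition bOmega : set (chi C) := Omega `&` closure Omega_max.

(** The extension of a character to Jbar: [chi_at x eps] is "x(eps) = 1". It
    does not depend on the way eps is written when x is in Omega, see
    [chi_atE]. *)
Definition chi_at x (eps : set C) : Prop :=
  exists e (F : set (J C)),
    [/\ is_diff eps e F, x e & forall f, F f -> ~~ x f].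

(** (s.x)(f) = x (s^-1 f s) *)
Definition act s x : chi C := fun f => `[< chi_at x (img s^-1 (val f)) >].

Lemma Jhat_and x e f : Jhat x -> x (Jand e f) = x e && x f.
Proof. by case=> _ + _; apply. Qed.

Lemma chi_at_sub x A e F e' : Omega x -> is_diff A e F -> x e ->
  (forall f, F f -> ~~ x f) -> A `<=` val e' -> x e'.
Proof.
move=> [hx px] [fF sF eA] xe xF Ae'.
have [|||f [Ff|->]] := px e (F `|` [set Jand e e']).
- by rewrite finite_setU.
- apply: seteq => z; split=> [ez|[f [/sF|-> []]//]]; last exact.
  have [[f Ff fz]|nz] := pselect (exists2 f, F f & val f z).
    by exists f => //; left.
  exists (Jand e e'); first by right.
  by split=> //; apply: Ae'; rewrite eA; split=> // -[f Ff fz]; apply: nz; exists f.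
- by [].
- by rewrite (negPf (xF _ Ff)).
- by rewrite Jhat_and// => /andP[].
Qed.

Lemma chi_at_disj x A e F f : Omega x -> is_diff A e F -> x e ->
  (forall f, F f -> ~~ x f) -> val f `&` A `<=` set0 -> ~~ x f.
Proof.
move=> [hx px] [fF sF eA] xe xF fA; apply/negP => xf.
have [||| _ [g Fg <-]] := px (Jand e f) [set Jand (Jand e f) g | g in F].
- exact: finite_image.
- apply: seteq => z; split=> [[ez fz]|[_ [g Fg <-] []]//].
  have [[g Fg gz]|nz] := pselect (exists2 g, F g & val g z).
    by exists (Jand (Jand e f) g); [exists g|].
  have : A z by rewrite eA; split=> // -[g Fg gz]; apply: nz; exists g.
  by move=> Az; case: (fA z).
- by rewrite Jhat_and// xe.
- by rewrite Jhat_and// (negPf (xF _ Fg)) andbF.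
Qed.

Lemma chi_atE x A e F : Omega x -> is_diff A e F ->
  chi_at x A <-> (x e /\ forall f, F f -> ~~ x f).
Proof.
move=> ox dA; split=> [[e' [F' [dA' xe' xF']]]|[xe xF]]; last by exists e, F.
split.
  by apply: (chi_at_sub ox dA' xe' xF'); case: dA => _ _ -> z [].
move=> f Ff; apply: (chi_at_disj ox dA' xe' xF'); case: dA => _ _ -> z [fz [_]].
by apply; exists f.
Qed.

Lemma chi_atS x A B : Omega x -> Jbar C B -> A `<=` B ->
  chi_at x A -> chi_at x B.
Proof.
move=> ox [e [F dB]] AB [e' [F' [dA' xe' xF']]]; exists e, F; split=> //.
  by apply: (chi_at_sub ox dA' xe' xF') => z /AB; case: dB => _ _ -> [].
move=> f Ff; apply: (chi_at_disj ox dA' xe' xF') => z [fz /AB].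
by case: dB => _ _ -> [_]; apply; exists f.
Qed.

Lemma chi_at_Jbar x A : chi_at x A -> Jbar C A.
Proof. by case=> e [F [dA _ _]]; exists e, F. Qed.

Lemma chi_atI x A B : Omega x -> chi_at x A -> chi_at x B -> chi_at x (A `&` B).
Proof.
move=> [hx _] [e [F [dA xe xF]]] [e' [F' [dB xe' xF']]].
eexists; eexists; split; first exact: is_diffI dA dB.
  by rewrite Jhat_and// xe.
move=> _ [f Ff <-]; rewrite Jhat_and// negb_and.
by apply/orP; right; case: Ff => [/xF|/xF'].
Qed.

Lemma chi_atIP x A B : Omega x -> Jbar C A -> Jbar C B ->
  chi_at x (A `&` B) <-> (chi_at x A /\ chi_at x B).
Proof.
move=> ox jA jB; split=> [h|[]]; last exact: chi_atI.
by split; apply: (chi_atS ox _ _ h) => // z [].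
Qed.

Lemma chi_atJ x e : Omega x -> chi_at x (val e) <-> x e.
Proof.
by move=> ox; rewrite (chi_atE ox (is_diff0 e)); split=> [[]|].
Qed.

Lemma act_restr t A x f (ht : Il C t) : Omega x -> chi_at x A ->
  act (restr t A) x f = x (Jimg (Il_inv ht) f).
Proof.
move=> ox xA; rewrite /act img_restrV -(asboolb (x _)); apply: asbool_equiv_eq.
rewrite -(chi_atJ (Jimg (Il_inv ht) f) ox) chi_atIP//.
- by split=> [[]|].
- exact: chi_at_Jbar xA.
- exact: (J_Jbar (Jimg (Il_inv ht) f)).
Qed.

Lemma chi_at_act s x A : Ilbar C s -> Omega x -> chi_at x s.`1 -> Jbar C A ->
  chi_at (act s x) A <-> chi_at x (img s^-1 A).
Proof.
move=> [t [d [ht hd td ->]]] ox; rewrite dom_restr// => xd [e [F dA]].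
have dA' := is_diff_img (Il_inv ht) dA.
have jA : Jbar C (img t^-1 A) by eexists; eexists; exact: dA'.
rewrite img_restrV chi_atIP// (chi_atE ox dA').
split=> [[e' [F' [dB xe xF]]]|[_ [xe xF]]].
  split=> //; apply/(chi_atE ox dA').
  have dB' := is_diff_img (Il_inv ht) dB; exists (Jimg (Il_inv ht) e').
  exists (Jimg (Il_inv ht) @` F'); split=> //; first by rewrite -(act_restr _ _ ox xd).
  by move=> _ [f Ff <-]; rewrite -(act_restr _ _ ox xd); exact: xF.
exists e, F; split=> //; first by rewrite (act_restr _ ht).
by move=> f Ff; rewrite (act_restr _ ht)//; apply: xF; exists f.
Qed.

Lemma act_comp s t x : Ilbar C s -> Ilbar C t -> Omega x -> chi_at x t.`1 ->
  act s (act t x) = act (s \; t) x.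
Proof.
move=> hs ht ox xt; apply/funext => f; apply: asbool_equiv_eq.
rewrite (chi_at_act ht ox xt); first by rewrite compV img_comp.
have [s' [d [hs' hd sd ->]]] := hs; rewrite img_restrV.
by apply: Jbar_setI => //; apply: Jbar_img; [exact: Il_inv|exact: J_Jbar].
Qed.

Lemma act_idrel A x : Omega x -> chi_at x A -> act (idrel A) x = x.
Proof.
move=> ox xA; apply/funext => f; rewrite /act img_idrelV -[RHS]asboolb.
apply: asbool_equiv_eq; rewrite chi_atIP ?chi_atJ//.
- by split=> [[]|].
- exact: chi_at_Jbar xA.
- exact: J_Jbar.
Qed.

Lemma act_eq_restr s A x : Ilbar C s -> Omega x -> chi_at x A ->
  act (restr s A) x = act s x.
Proof.
move=> hs ox xA; rewrite -comp_idrel -act_comp//.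
- by rewrite act_idrel.
- exact/Ilbar_idrel/chi_at_Jbar/xA.
- by rewrite dom_idrel.
Qed.

Lemma actK s x : Ilbar C s -> Omega x -> chi_at x s.`1 ->
  act s^-1 (act s x) = x.
Proof.
move=> hs ox xs; rewrite act_comp//; last exact: Ilbar_inv.
by rewrite (relK (pbij_Ilbar hs)) act_idrel.
Qed.

Lemma chi_at_act_dom s x : Ilbar C s -> Omega x -> chi_at x s.`1 ->
  chi_at (act s x) (s^-1).`1.
Proof.
move=> hs ox xs; apply/chi_at_act => //; last by rewrite img_dom.
exact/Jbar_dom/Ilbar_inv.
Qed.

Lemma chi_at_comp s t x : Ilbar C s -> Ilbar C t -> Omega x -> chi_at x t.`1 ->
  chi_at (act t x) s.`1 -> chi_at x (s \; t).`1.
Proof.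
move=> hs ht ox xt /chi_at_act; rewrite dom_comp; apply=> //.
exact: Jbar_dom.
Qed.

Lemma Jhat_true x : Jhat x -> exists e, x e.
Proof. by case. Qed.

Lemma max_disj x f : Omega_max x -> ~~ x f ->
  exists2 g, x g & val g `&` val f = set0.
Proof.
move=> [hx mx] xf; apply: contrapT => ng.
have {}ng g : x g -> (val g `&` val f) !=set0.
  by move=> xg; apply/set0P/eqP => e; apply: ng; exists g.
pose y : chi C := fun e => `[< exists2 g, x g & val g `&` val f `<=` val e >].
have hy : Jhat y.
  have [[g xg] mlt x0] := hx; split.
  - by exists g; apply/asboolP; exists g => // z [].
  - move=> a b c abc; apply/asboolP/andP => [[h xh hf]|[]].
      by split; apply/asboolP; exists h => // z /hf; rewrite abc => -[].
    move=> /asboolP[h xh hf] /asboolP[k xk kf].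
    exists (Jand h k); first by rewrite Jhat_and// xh.
    by rewrite abc => z [[hz kz] fz]; split; [exact: hf|exact: kf].
  - move=> e e0; apply/asboolP => -[h xh]; rewrite e0 => hf.
    by have [z /hf] := ng _ xh.
have yx : y = x.
  by apply: mx => // e /= xe; apply/asboolP; exists e => // z [].
move: xf; rewrite -yx => /negP; apply; apply/asboolP.
by have [g xg] := Jhat_true hx; exists g => // z [].
Qed.

Lemma Omega_max_Omega : Omega_max `<=` Omega.
Proof.
move=> x mx; have hx := mx.1; split=> // e F fF eF xe.
apply: contrapT => nF.
have {}nF f : F f -> ~~ x f by move=> Ff; apply/negP => xf; apply: nF; exists f.
have [g xg gF] : exists2 g, x g & forall f, F f -> val g `&` val f = set0.
  have /finite_seqP[r Fr] := fF; move: nF; rewrite Fr => {eF Fr fF F}.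
  elim: r => [_|a r ih nF]; first by exists e.
  have [|g xg gF] := ih; first by move=> f /= fr; apply: nF; rewrite /= inE fr orbT.
  have [|h xh hF] := @max_disj x a mx; first by apply: nF; rewrite /= inE eqxx.
  exists (Jand g h); first by rewrite Jhat_and// xg.
  move=> f; rewrite /= inE => /orP[/eqP ->|fr].
    by rewrite -setIA hF setI0.
  by rewrite (setIC (val g)) -setIA gF// setI0.
have : x (Jand g e) by rewrite Jhat_and// xg.
apply/negP; case: hx => _ _; apply; apply: seteq => z; split=> // -[gz] /=.
by rewrite eF => -[f /gF/seteqP[h _] fz]; exact: (h z).
Qed.

Lemma open_coord (e : J C) (b : bool) : open [set x : chi C | x e = b].
Proof.
apply: (@open_comp (chi C) bool (fun x => x e) [set b]).
  by move=> x _; exact: (@proj_continuous (J C) (fun=> bool) e).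
exact: discrete_open.
Qed.

Lemma chi_at_open A : Jbar C A ->
  exists2 V : set (chi C), open V & forall x, Omega x -> chi_at x A <-> V x.
Proof.
move=> [e [F dA]]; have [fF _ _] := dA; have /finite_seqP[r Fr] := fF.
exists ([set x : chi C | x e = true] `&`
        \bigcap_(f in [set` r]) [set x : chi C | x f = false]).
  apply: openI; first exact: open_coord.
  by rewrite bigcap_seq; apply: big_ind => [||f _];
    [exact: openT|exact: openI|exact: open_coord].
move=> x ox; rewrite (chi_atE ox dA) Fr; split=> -[xe xF]; split=> // f /xF.
  by move=> /negPf.
by move=> /= ->.
Qed.

Lemma continuous_precomp (h : J C -> J C) :
  continuous (fun x : chi C => (fun e => x (h e)) : chi C).
Proof.
move=> x; apply/cvg_sup => e A [_ [[B oB <-] Bx sB]].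
apply: (filterS sB); apply: (@proj_continuous (J C) (fun=> bool) (h e) x).
exact: open_nbhs_nbhs.
Qed.

Lemma Omega_act s x : Ilbar C s -> Omega x -> chi_at x s.`1 -> Omega (act s x).
Proof.
move=> [t [d [ht hd td ->]]] ox; rewrite dom_restr// => xd.
have [inj fn] := pbij_Il ht.
have actE f := act_restr f ht ox xd.
have [hx px] := ox.
have dt : J C t.`1 by exists t.
have xt : x (mkJ dt) by apply/(chi_atJ _ ox)/(chi_atS ox _ td xd)/(J_Jbar (mkJ dt)).
split; first split.
- exists (Jimg ht (mkJ dt)); rewrite actE.
  suff -> : Jimg (Il_inv ht) (Jimg ht (mkJ dt)) = mkJ dt by [].
  apply: J_inj; apply: seteq => z /=; split.
    by move=> [w [u _ tu] tz]; exists w.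
  by move=> [w tw]; exists w => //; exists z => //; exists w.
- move=> e f g gef; rewrite !actE; have [_ mlt _] := hx; apply: mlt.
  apply: seteq => z /=; rewrite gef; split.
    by move=> [y [ey fy] tz]; split; exists y.
  move=> [[y ey ty] [w fw tw]]; exists y => //; split=> //.
  by rewrite (inj z y w)//.
- move=> e e0; rewrite actE; have [_ _] := hx; apply.
  by apply: seteq => z; split=> //= -[y]; rewrite e0.
move=> e F fF eF; rewrite actE => xe.
have [|| _ [f Ff <-] xf] := px _ (Jimg (Il_inv ht) @` F) _ _ xe.
- exact: finite_image.
- apply: seteq => z /=; rewrite eF; split.
    by move=> [y [f Ff fy] tz]; exists (Jimg (Il_inv ht) f); [exists f|exists y].
  by move=> [_ [f Ff <-] [y fy tz]]; exists y => //; exists f.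
- by exists f => //; rewrite actE.
Qed.

Lemma Omega_max_act s x : Ilbar C s -> Omega_max x -> chi_at x s.`1 ->
  Omega_max (act s x).
Proof.
move=> hs mx xs; have [hax _] := Omega_act hs (Omega_max_Omega mx) xs.
move: hs xs hax => [t [d [ht hd td ->]]]; rewrite dom_restr// => xd hax.
have ox := Omega_max_Omega mx.
have [inj fn] := pbij_Il ht.
have actE f := act_restr f ht ox xd.
have dt : J C t.`1 by exists t.
have xt : x (mkJ dt) by apply/(chi_atJ _ ox)/(chi_atS ox _ td xd)/(J_Jbar (mkJ dt)).
pose pull (y : chi C) : chi C := fun e => y (Jimg ht e).
split=> //.
move=> y hy xy.
have pully : pull y = x.
  apply: mx.2.
    split.
    - exists (mkJ dt); apply: xy => /=; rewrite actE.
      suff -> : Jimg (Il_inv ht) (Jimg ht (mkJ dt)) = mkJ dt by [].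
      apply: J_inj; apply: seteq => z /=; split.
        by move=> [w [u _ tu] tz]; exists w.
      by move=> [w tw]; exists w => //; exists z => //; exists w.
    - move=> e f g gef; rewrite /pull; have [_ mlt _] := hy; apply: mlt.
      apply: seteq => z /=; rewrite gef; split.
        by move=> [w [ew fw] tz]; split; exists w.
      move=> [[w ew tw] [u fu tu]]; exists w => //; split=> //.
      by rewrite (fn w u z)//.
    - move=> e e0; rewrite /pull; have [_ _] := hy; apply.
      by apply: seteq => z; split=> //= -[w]; rewrite e0.
  move=> e /= xe; apply: xy => /=; rewrite actE.
  apply/(chi_atJ _ ox); apply: (@chi_atS _ (val (Jand e (mkJ dt)))) => //.
  - exact: (J_Jbar (Jimg (Il_inv ht) (Jimg ht e))).
  - by move=> z /= [ez [w tw]]; exists w => //; exists z.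
  - by apply/(chi_atJ _ ox); rewrite Jhat_and ?xe//; exact: mx.1.
apply/funext => f; rewrite actE -pully /pull.
have dt' : J C (t^-1).`1 by exists t^-1 => //; exact: Il_inv.
have yt : y (mkJ dt').
  apply: xy => /=; rewrite actE.
  suff -> : Jimg (Il_inv ht) (mkJ dt') = mkJ dt by [].
  apply: J_inj; apply: seteq => z /=; split.
    by move=> [w _ tw]; exists w.
  by move=> [w tw]; exists w => //; exists z.
have -> : Jimg ht (Jimg (Il_inv ht) f) = Jand f (mkJ dt').
  apply: J_inj; apply: seteq => z /=; split.
    move=> [w [u fu tu] tw]; rewrite (inj w z u)//.
    by split=> //; exists w.
  by move=> [fz [w tw]]; exists w => //; exists z.
by rewrite Jhat_and// yt andbT.
Qed.

Lemma act_continuous s : Ilbar C s -> exists2 p : chi C -> chi C, continuous p &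
  forall x, Omega x -> chi_at x s.`1 -> act s x = p x.
Proof.
move=> [t [d [ht hd td ->]]]; rewrite dom_restr//.
exists (fun x e => x (Jimg (Il_inv ht) e)); first exact: continuous_precomp.
by move=> x ox xd; apply/funext => e; exact: act_restr.
Qed.

Lemma bOmega_act s x : Ilbar C s -> bOmega x -> chi_at x s.`1 ->
  bOmega (act s x).
Proof.
move=> hs [ox cx] xs; split; first exact: Omega_act.
have [p cp pE] := act_continuous hs; have [V oV VE] := chi_at_open (Jbar_dom hs).
rewrite pE// => B nB; have pB : nbhs x (p @^-1` B) by exact: cp.
have nV : nbhs x V by apply: open_nbhs_nbhs; split=> //; exact/VE.
have [y [my [pBy Vy]]] := cx _ (filterI pB nV).
have oy := Omega_max_Omega my; have ys : chi_at y s.`1 by exact/VE.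
by exists (p y); split=> //; rewrite -pE//; exact: Omega_max_act.
Qed.

End Characters.
Arguments bOmega : clear implicits.
Arguments Omega : clear implicits.

Record invSemigroup (C : lcCategoryType) := InvSemigroup {
  isg :> set (set (C * C));
  isg_sub : isg `<=` Ilbar C;
  isg_inv : forall s, isg s -> isg s^-1;
  isg_comp : forall s t, isg s -> isg t -> isg (s \; t)
}.

Definition Il_isg (C : lcCategoryType) : invSemigroup C :=
  InvSemigroup (@Il_Ilbar C) (@Il_inv C) (@Il_comp C).

Definition Ilbar_isg (C : lcCategoryType) : invSemigroup C :=
  InvSemigroup (fun s h => h) (@Ilbar_inv C) (@Ilbar_comp C).

(** The groupoid of germs [s, chi], s in S and chi in bOmega, both for S = Il
    and for S = Ilbar. *)
Section Germs.
Context {C : lcCategoryType} {S : invSemigroup C}.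
Implicit Types (s t u : set (C * C)) (x y : chi C).

Definition germ_dom s : set (chi C) :=
  [set x : chi C | bOmega C x /\ chi_at x s.`1].

(** pairs (s, chi), topologized as a disjoint union over s of subspaces of the
    space of characters *)
Definition pregerm := {s : S & germ_dom (val s)}.
HB.instance Definition _ := Topological.on pregerm.

Definition pg_elt (p : pregerm) : set (C * C) := val (tag p).
Definition pg_chi (p : pregerm) : chi C := val (tagged p).

Definition same_germ s t x :=
  exists A, [/\ Jbar C A, chi_at x A & restr s A = restr t A].

Definition germ_rel (p q : pregerm) : bool :=
  `[< pg_chi p = pg_chi q /\ same_germ (pg_elt p) (pg_elt q) (pg_chi p) >].

Lemma pg_eltP (p : pregerm) : isg S (pg_elt p).
Proof. exact: set_mem (valP (tag p)). Qed.

Lemma pg_chiP (p : pregerm) : germ_dom (pg_elt p) (pg_chi p).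
Proof. exact: set_mem (valP (tagged p)). Qed.

Lemma same_germ_refl s x : Ilbar C s -> chi_at x s.`1 -> same_germ s s x.
Proof. by move=> hs xs; exists s.`1; split=> //; exact: Jbar_dom. Qed.

Lemma same_germ_sym s t x : same_germ s t x -> same_germ t s x.
Proof. by move=> [A [? ? ?]]; exists A. Qed.

Lemma same_germ_trans t s u x : Omega C x -> same_germ s t x ->
  same_germ t u x -> same_germ s u x.
Proof.
move=> ox [A [jA xA eA]] [B [jB xB eB]]; exists (A `&` B); split.
- exact: Jbar_setI.
- exact: chi_atI.
- by rewrite -restr_restr eA restr_restr setIC -restr_restr eB restr_restr.
Qed.

Lemma germ_rel_refl : reflexive germ_rel.
Proof.
move=> p; apply/asboolP; split=> //; apply: same_germ_refl.
  exact/(isg_sub (i := S))/pg_eltP.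
by case: (pg_chiP p).
Qed.

Lemma germ_rel_sym : symmetric germ_rel.
Proof.
by move=> p q; apply: asbool_equiv_eq; split=> -[e h]; split=> //;
  [rewrite -e|rewrite e in h *]; exact: same_germ_sym.
Qed.

Lemma germ_rel_trans : transitive germ_rel.
Proof.
move=> q p r /asboolP[e1 h1] /asboolP[e2 h2]; apply/asboolP; split.
  by rewrite e1.
apply: (@same_germ_trans (pg_elt q)) => //; last by rewrite e1.
by case: (pg_chiP p) => -[].
Qed.

Canonical germ_equiv :=
  EquivRel germ_rel germ_rel_refl germ_rel_sym germ_rel_trans.

(** With the quotient topology, the set of all germs [s, chi] for a given s is
    open, and the source map is a homeomorphism from it onto [germ_dom s], see
    [germ_slice]. *)
Definition germ := quotient_topology {eq_quot germ_equiv}.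
HB.instance Definition _ := Topological.on germ.
HB.instance Definition _ := Quotient.on germ.

Definition mkpre s x (hs : isg S s) (hx : germ_dom s x) : pregerm :=
  existT _ (exist _ s (mem_set hs) : S) (exist _ x (mem_set hx)).

(** [s, x] when it makes sense, and g0 otherwise *)
Definition bracket (g0 : germ) s x : germ :=
  match pselect (isg S s /\ germ_dom s x) with
  | left h => \pi_germ (mkpre h.1 h.2)
  | right _ => g0
  end.

Definition germ_elt (g : germ) := pg_elt (repr g).
Definition germ_src (g : germ) := pg_chi (repr g).
Definition germ_rng (g : germ) := act (germ_elt g) (germ_src g).

Lemma pi_eq (p q : pregerm) : \pi_germ p = \pi_germ q <-> germ_rel p q.
Proof. by split=> [/eqmodP|h]; last exact/eqmodP. Qed.

Lemma bracketE g0 s x (h1 : isg S s) (h2 : germ_dom s x) :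
  bracket g0 s x = \pi_germ (mkpre h1 h2).
Proof.
rewrite /bracket; case: pselect => [[h1' h2']|[]//].
by apply/pi_eq; exact: germ_rel_refl.
Qed.

Lemma germ_eltP g : isg S (germ_elt g). Proof. exact: pg_eltP. Qed.
Lemma germ_srcP g : germ_dom (germ_elt g) (germ_src g).
Proof. exact: pg_chiP. Qed.
Lemma isgI s : isg S s -> Ilbar C s. Proof. exact: isg_sub. Qed.
Lemma germ_eltI g : Ilbar C (germ_elt g). Proof. exact/isgI/germ_eltP. Qed.
Lemma germ_srcO g : Omega C (germ_src g). Proof. by case: (germ_srcP g) => -[]. Qed.
Lemma germ_src_at g : chi_at (germ_src g) (germ_elt g).`1.
Proof. by case: (germ_srcP g). Qed.

Lemma bracketK g0 g : bracket g0 (germ_elt g) (germ_src g) = g.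
Proof.
rewrite (bracketE _ (germ_eltP g) (germ_srcP g)) -[RHS]reprK.
by apply/pi_eq; exact: germ_rel_refl.
Qed.

Lemma bracket_inj g0 g1 s t x y : isg S s -> germ_dom s x -> isg S t ->
  germ_dom t y ->
  bracket g0 s x = bracket g1 t y <-> x = y /\ same_germ s t x.
Proof.
move=> h1 h2 h3 h4; rewrite (bracketE _ h1 h2) (bracketE _ h3 h4) pi_eq.
by split=> [/asboolP|h]; last exact/asboolP.
Qed.

Lemma bracket_src g0 s x : isg S s -> germ_dom s x ->
  germ_src (bracket g0 s x) = x /\ same_germ (germ_elt (bracket g0 s x)) s x.
Proof.
move=> h1 h2; set g := bracket g0 s x.
have /bracket_inj : bracket g (germ_elt g) (germ_src g) = bracket g0 s x.
  by rewrite bracketK.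
case=> //; [exact: germ_eltP|exact: germ_srcP|].
by move=> e; rewrite e.
Qed.

Lemma germ_eqP g h :
  g = h <-> germ_src g = germ_src h /\
            same_germ (germ_elt g) (germ_elt h) (germ_src g).
Proof.
rewrite -{1}(bracketK g g) -{1}(bracketK g h); apply: bracket_inj;
  by [exact: germ_eltP|exact: germ_srcP].
Qed.

Lemma same_germ_act s t x : Ilbar C s -> Ilbar C t -> Omega C x ->
  same_germ s t x -> act s x = act t x.
Proof.
move=> hs ht ox [A [jA xA e]].
by rewrite -(act_eq_restr hs ox xA) e act_eq_restr.
Qed.

Lemma bracket_rng g0 s x : isg S s -> germ_dom s x ->
  germ_rng (bracket g0 s x) = act s x.
Proof.
move=> h1 h2; have [e h] := bracket_src g0 h1 h2; rewrite /germ_rng e.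
by apply: same_germ_act => //; [exact: germ_eltI|exact: isgI|case: h2 => -[]].
Qed.

Lemma same_germ_comp s s' t t' x : Ilbar C t -> Ilbar C t' -> Omega C x ->
  chi_at x t.`1 ->
  same_germ t t' x -> same_germ s s' (act t x) ->
  same_germ (s \; t) (s' \; t') x.
Proof.
move=> ht ht' ox xt [A [jA xA eA]] [B [jB xB eB]].
have xB' : chi_at x (img t^-1 B) by apply/(chi_at_act ht ox xt).
have {}xB := chi_atI ox xA xB'.
exists (A `&` img t^-1 B); split=> //; first exact: chi_at_Jbar xB.
have [tf _] := pbij_Ilbar ht.
have tA a b : A a -> t (a, b) <-> t' (a, b).
  move=> Aa; have e : (A a /\ t (a, b)) = (A a /\ t' (a, b)).
    exact: (congr1 (fun u : set (C * C) => u (a, b)) eA).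
  split=> h; first by suff : A a /\ t' (a, b); [case|rewrite -e].
  by suff : A a /\ t (a, b); [case|rewrite e].
have sB a b : B a -> s (a, b) <-> s' (a, b).
  move=> Ba; have e : (B a /\ s (a, b)) = (B a /\ s' (a, b)).
    exact: (congr1 (fun u : set (C * C) => u (a, b)) eB).
  split=> h; first by suff : B a /\ s' (a, b); [case|rewrite -e].
  by suff : B a /\ s (a, b); [case|rewrite e].
apply: releqP => a b /=; split=> -[[Aa [c Bc tc]] [d td sd]].
  split; first by split=> //; exists c.
  have cd : c = d by exact: tf tc td.
  by subst d; exists c; [apply/tA|apply/sB].
split; first by split=> //; exists c.
have cd : c = d by apply: (tf _ _ _ tc); exact/tA.
by subst d; exists c; [apply/tA|apply/sB].
Qed.

Lemma germ_dom_idrel A x : bOmega C x -> chi_at x A -> germ_dom (idrel A) x.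
Proof. by move=> bx xA; split=> //; rewrite dom_idrel. Qed.

Lemma germ_dom_act s x : isg S s -> germ_dom s x -> germ_dom s^-1 (act s x).
Proof.
move=> hs [bx xs]; split; first exact/bOmega_act/xs/bx/isgI.
by apply: chi_at_act_dom => //; [exact: isgI|case: bx].
Qed.

Lemma isg_idV s : isg S s -> isg S (idrel s.`1).
Proof.
move=> hs; rewrite -(relK (pbij_Ilbar (isgI hs))).
by apply: isg_comp => //; exact: isg_inv.
Qed.

Lemma germ_dom_comp s t x : isg S s -> isg S t -> germ_dom t x ->
  germ_dom s (act t x) -> germ_dom (s \; t) x.
Proof.
move=> hs ht [bx xt] [_ xs]; split=> //; apply: chi_at_comp => //.
- exact: isgI.
- exact: isgI.
- by case: bx.
Qed.

Lemma same_germ_idrel A B x : Omega C x -> chi_at x A -> chi_at x B ->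
  same_germ (idrel A) (idrel B) x.
Proof.
move=> ox xA xB; have xAB := chi_atI ox xA xB.
exists (A `&` B); split=> //; first exact: chi_at_Jbar xAB.
by apply: releqP => a b /=; split=> -[[? ?] [_ ?]].
Qed.

(** The groupoid operations: source and range are the unit germs
    [s^-1 s, chi] and [s s^-1, s.chi], the product is
    [s, t.chi] [t, chi] = [s t, chi] and the inverse [s^-1, s.chi]. *)
Definition germ_d (g : germ) :=
  bracket g ((germ_elt g)^-1 \; germ_elt g) (germ_src g).
Definition germ_t (g : germ) :=
  bracket g (germ_elt g \; (germ_elt g)^-1) (germ_rng g).
Definition germ_mul (g h : germ) :=
  bracket g (germ_elt g \; germ_elt h) (germ_src h).
Definition germ_inv (g : germ) := bracket g (germ_elt g)^-1 (germ_rng g).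

Definition germ_unit (g0 : germ) A x := bracket g0 (idrel A) x.

Lemma germ_rngP g : germ_dom (germ_elt g)^-1 (germ_rng g).
Proof. by apply: germ_dom_act; [exact: germ_eltP|exact: germ_srcP]. Qed.

Lemma germ_rngO g : Omega C (germ_rng g). Proof. by case: (germ_rngP g) => -[]. Qed.

Lemma germ_dE g : germ_d g = germ_unit g (germ_elt g).`1 (germ_src g).
Proof. by rewrite /germ_d (relK (pbij_Ilbar (germ_eltI g))). Qed.

Lemma germ_tE g : germ_t g = germ_unit g (germ_elt g)^-1.`1 (germ_rng g).
Proof.
rewrite /germ_t -{1}(relVV (germ_elt g)) (@relK _ (germ_elt g)^-1)//.
exact: pbijV (pbij_Ilbar (germ_eltI g)).
Qed.

Lemma germ_unit_eq g0 g1 A B x y :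
  isg S (idrel A) -> isg S (idrel B) -> bOmega C x -> bOmega C y ->
  chi_at x A -> chi_at y B ->
  germ_unit g0 A x = germ_unit g1 B y <-> x = y.
Proof.
move=> hA hB bx by_ xA yB; rewrite bracket_inj//; try exact: germ_dom_idrel.
split=> [[]//|e]; split=> //; apply: same_germ_idrel => //; first by case: bx.
by rewrite e.
Qed.

Lemma germ_d_ax g : [/\ isg S (idrel (germ_elt g).`1), bOmega C (germ_src g) &
  chi_at (germ_src g) (germ_elt g).`1].
Proof.
by have [? ?] := germ_srcP g; split=> //; exact/isg_idV/germ_eltP.
Qed.

Lemma germ_t_ax g : [/\ isg S (idrel (germ_elt g)^-1.`1), bOmega C (germ_rng g) &
  chi_at (germ_rng g) (germ_elt g)^-1.`1].
Proof.
by have [? ?] := germ_rngP g; split=> //; exact/isg_idV/isg_inv/germ_eltP.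
Qed.

Lemma germ_ddP g h : germ_d g = germ_d h <-> germ_src g = germ_src h.
Proof.
rewrite !germ_dE; have [? ? ?] := germ_d_ax g; have [? ? ?] := germ_d_ax h.
exact: germ_unit_eq.
Qed.

Lemma germ_dtP g h : germ_d g = germ_t h <-> germ_src g = germ_rng h.
Proof.
rewrite germ_dE germ_tE; have [? ? ?] := germ_d_ax g.
by have [? ? ?] := germ_t_ax h; exact: germ_unit_eq.
Qed.

Lemma germ_ttP g h : germ_t g = germ_t h <-> germ_rng g = germ_rng h.
Proof.
rewrite !germ_tE; have [? ? ?] := germ_t_ax g; have [? ? ?] := germ_t_ax h.
exact: germ_unit_eq.
Qed.

Lemma unit_src g0 A x : isg S (idrel A) -> bOmega C x -> chi_at x A ->
  [/\ germ_src (germ_unit g0 A x) = x, germ_rng (germ_unit g0 A x) = x &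
      same_germ (germ_elt (germ_unit g0 A x)) (idrel A) x].
Proof.
move=> hA bx xA; have hx := germ_dom_idrel bx xA.
have [e h] := bracket_src g0 hA hx; split=> //.
by rewrite bracket_rng// act_idrel//; case: bx.
Qed.

Lemma germ_d_src g : germ_src (germ_d g) = germ_src g.
Proof. by have [h1 h2 h3] := germ_d_ax g; rewrite germ_dE; case: (unit_src g h1 h2 h3). Qed.

Lemma germ_d_rng g : germ_rng (germ_d g) = germ_src g.
Proof. by have [h1 h2 h3] := germ_d_ax g; rewrite germ_dE; case: (unit_src g h1 h2 h3). Qed.

Lemma germ_d_elt g :
  same_germ (germ_elt (germ_d g)) (idrel (germ_elt g).`1) (germ_src g).
Proof. by have [h1 h2 h3] := germ_d_ax g; rewrite germ_dE; case: (unit_src g h1 h2 h3). Qed.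

Lemma germ_t_src g : germ_src (germ_t g) = germ_rng g.
Proof. by have [h1 h2 h3] := germ_t_ax g; rewrite germ_tE; case: (unit_src g h1 h2 h3). Qed.

Lemma germ_t_rng g : germ_rng (germ_t g) = germ_rng g.
Proof. by have [h1 h2 h3] := germ_t_ax g; rewrite germ_tE; case: (unit_src g h1 h2 h3). Qed.

Lemma germ_t_elt g :
  same_germ (germ_elt (germ_t g)) (idrel (germ_elt g)^-1.`1) (germ_rng g).
Proof. by have [h1 h2 h3] := germ_t_ax g; rewrite germ_tE; case: (unit_src g h1 h2 h3). Qed.

Section Product.
Variables (g h : germ) (gh : germ_src g = germ_rng h).

Lemma germ_mulP : isg S (germ_elt g \; germ_elt h) /\
  germ_dom (germ_elt g \; germ_elt h) (germ_src h).
Proof.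
have := germ_srcP g; rewrite gh => gP.
split; first by apply: isg_comp; exact: germ_eltP.
by apply: germ_dom_comp => //; [exact: germ_eltP|exact: germ_eltP|exact: germ_srcP].
Qed.

Lemma germ_mul_src : germ_src (germ_mul g h) = germ_src h.
Proof. by have [h1 h2] := germ_mulP; case: (bracket_src g h1 h2). Qed.

Lemma germ_mul_elt : same_germ (germ_elt (germ_mul g h))
  (germ_elt g \; germ_elt h) (germ_src h).
Proof. by have [h1 h2] := germ_mulP; case: (bracket_src g h1 h2). Qed.

Lemma germ_mul_rng : germ_rng (germ_mul g h) = germ_rng g.
Proof.
have [h1 h2] := germ_mulP; rewrite bracket_rng// /germ_rng gh act_comp//.
- exact: germ_eltI.
- exact: germ_eltI.
- exact: germ_srcO.
- exact: germ_src_at.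
Qed.

Lemma germ_mul_same s t : Ilbar C s -> Ilbar C t ->
  same_germ (germ_elt g) s (germ_src g) -> same_germ (germ_elt h) t (germ_src h) ->
  same_germ (germ_elt (germ_mul g h)) (s \; t) (germ_src h).
Proof.
move=> hs ht sg sh; apply: same_germ_trans germ_mul_elt _; first exact: germ_srcO.
apply: same_germ_comp => //.
- exact: germ_eltI.
- exact: germ_srcO.
- exact: germ_src_at.
- by move: sg; rewrite gh.
Qed.

End Product.

Lemma germ_refl g : same_germ (germ_elt g) (germ_elt g) (germ_src g).
Proof. by apply: same_germ_refl; [exact: germ_eltI|exact: germ_src_at]. Qed.

Lemma idI g : Ilbar C (idrel (germ_elt g).`1).
Proof. by case: (germ_d_ax g) => /isgI. Qed.

Lemma idVI g : Ilbar C (idrel (germ_elt g)^-1.`1).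
Proof. by case: (germ_t_ax g) => /isgI. Qed.

Lemma germ_dom_tgt g : germ_d (germ_t g) = germ_t g.
Proof.
rewrite germ_dE germ_tE; have [h1 h2 h3] := germ_t_ax g.
have [e1 e2 e3] := unit_src g h1 h2 h3.
set u := germ_unit g _ _ in e1 e2 e3 *.
have [? ? ?] := germ_d_ax u.
by apply/germ_unit_eq; rewrite // e1.
Qed.

Lemma germ_tgt_dom g : germ_t (germ_d g) = germ_d g.
Proof.
rewrite germ_dE germ_tE; have [h1 h2 h3] := germ_d_ax g.
have [e1 e2 e3] := unit_src g h1 h2 h3.
set u := germ_unit g _ _ in e1 e2 e3 *.
have [? ? ?] := germ_t_ax u.
by apply/germ_unit_eq; rewrite // e2.
Qed.

Lemma germ_dom_mul g h : germ_d g = germ_t h -> germ_d (germ_mul g h) = germ_d h.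
Proof. by move/germ_dtP => gh; apply/germ_ddP; exact: germ_mul_src. Qed.

Lemma germ_tgt_mul g h : germ_d g = germ_t h -> germ_t (germ_mul g h) = germ_t g.
Proof. by move/germ_dtP => gh; apply/germ_ttP; exact: germ_mul_rng. Qed.

Lemma germ_mul_dom g : germ_mul g (germ_d g) = g.
Proof.
have gd : germ_src g = germ_rng (germ_d g) by rewrite germ_d_rng.
apply/germ_eqP; rewrite germ_mul_src// germ_d_src; split=> //.
have := @germ_mul_same g (germ_d g) gd (germ_elt g) (idrel (germ_elt g).`1).
rewrite germ_d_src comp_idrel restr_dom; apply.
- exact: germ_eltI.
- exact: idI.
- exact: germ_refl.
- exact: germ_d_elt.
Qed.

Lemma germ_mul_tgt g : germ_mul (germ_t g) g = g.
Proof.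
have gd : germ_src (germ_t g) = germ_rng g by rewrite germ_t_src.
apply/germ_eqP; rewrite germ_mul_src//; split=> //.
have := @germ_mul_same (germ_t g) g gd (idrel (germ_elt g)^-1.`1) (germ_elt g).
have -> : idrel (germ_elt g)^-1.`1 \; germ_elt g = germ_elt g.
  apply: releqP => a b /=; split=> [[c ac [_ e]]|ab]; first by rewrite (e : b = c).
  by exists b => //; split=> //; exists a.
rewrite germ_t_src; apply.
- exact: idVI.
- exact: germ_eltI.
- exact: germ_t_elt.
- exact: germ_refl.
Qed.

Lemma compI g h : Ilbar C (germ_elt g \; germ_elt h).
Proof. by apply: Ilbar_comp; exact: germ_eltI. Qed.

Lemma germ_mulA f g h : germ_d f = germ_t g -> germ_d g = germ_t h ->
  germ_mul f (germ_mul g h) = germ_mul (germ_mul f g) h.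
Proof.
move=> /germ_dtP fg /germ_dtP gh.
have fgh : germ_src f = germ_rng (germ_mul g h) by rewrite germ_mul_rng.
have fg_h : germ_src (germ_mul f g) = germ_rng h by rewrite germ_mul_src.
apply/germ_eqP; rewrite !germ_mul_src//; split=> //.
have l : same_germ (germ_elt (germ_mul f (germ_mul g h)))
    (germ_elt f \; (germ_elt g \; germ_elt h)) (germ_src h).
  rewrite -(germ_mul_src gh); apply: germ_mul_same => //.
  - exact: germ_eltI.
  - exact: compI.
  - exact: germ_refl.
  - by rewrite germ_mul_src//; exact: germ_mul_elt.
have r : same_germ (germ_elt (germ_mul (germ_mul f g) h))
    ((germ_elt f \; germ_elt g) \; germ_elt h) (germ_src h).
  apply: germ_mul_same => //.
  - exact: compI.
  - exact: germ_eltI.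
  - by rewrite germ_mul_src//; exact: germ_mul_elt.
  - exact: germ_refl.
apply: (same_germ_trans (germ_srcO h) l).
by rewrite relA; exact: same_germ_sym.
Qed.

Lemma germ_inv_ax g : isg S (germ_elt g)^-1 /\
  germ_dom (germ_elt g)^-1 (germ_rng g).
Proof. by split; [exact/isg_inv/germ_eltP|exact: germ_rngP]. Qed.

Lemma germ_inv_src g : germ_src (germ_inv g) = germ_rng g.
Proof. by have [h1 h2] := germ_inv_ax g; case: (bracket_src g h1 h2). Qed.

Lemma germ_inv_elt g :
  same_germ (germ_elt (germ_inv g)) (germ_elt g)^-1 (germ_rng g).
Proof. by have [h1 h2] := germ_inv_ax g; case: (bracket_src g h1 h2). Qed.

Lemma germ_inv_rng g : germ_rng (germ_inv g) = germ_src g.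
Proof.
have [h1 h2] := germ_inv_ax g; rewrite bracket_rng// /germ_rng actK//.
- exact: germ_eltI.
- exact: germ_srcO.
- exact: germ_src_at.
Qed.

Lemma germ_dom_inv g : germ_d (germ_inv g) = germ_t g.
Proof. by apply/germ_dtP; exact: germ_inv_src. Qed.

Lemma germ_tgt_inv g : germ_t (germ_inv g) = germ_d g.
Proof. by apply/esym/germ_dtP; rewrite germ_inv_rng. Qed.

Lemma invI g : Ilbar C (germ_elt g)^-1.
Proof. exact/Ilbar_inv/germ_eltI. Qed.

Lemma germ_mul_invl g : germ_mul (germ_inv g) g = germ_d g.
Proof.
have c := germ_inv_src g.
apply/germ_eqP; rewrite germ_mul_src// germ_d_src; split=> //.
apply: (same_germ_trans (germ_srcO g)); last exact/same_germ_sym/germ_d_elt.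
rewrite -(relK (pbij_Ilbar (germ_eltI g))); apply: germ_mul_same => //.
- exact: invI.
- exact: germ_eltI.
- by rewrite c; exact: germ_inv_elt.
- exact: germ_refl.
Qed.

Lemma germ_mul_invr g : germ_mul g (germ_inv g) = germ_t g.
Proof.
have c := esym (germ_inv_rng g).
apply/germ_eqP; rewrite germ_mul_src// germ_t_src germ_inv_src; split=> //.
apply: (same_germ_trans (germ_rngO g)); last exact/same_germ_sym/germ_t_elt.
rewrite -(@relK _ (germ_elt g)^-1) ?relVV; last exact/pbij_Ilbar/invI.
rewrite -germ_inv_src; apply: germ_mul_same => //.
- exact: germ_eltI.
- exact: invI.
- exact: germ_refl.
- by rewrite germ_inv_src; exact: germ_inv_elt.
Qed.

HB.instance Definition _ := isCategory.Build germ germ_dom_tgt germ_tgt_dom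
  germ_dom_mul germ_tgt_mul germ_mul_dom germ_mul_tgt germ_mulA.
HB.instance Definition _ := isGroupoid.Build germ germ_dom_inv germ_tgt_inv
  germ_mul_invl germ_mul_invr.

Lemma germ_openP (U : set germ) : open U <->
  forall s (hs : isg S s), exists2 V : set (chi C), open V &
    forall x (hx : germ_dom s x), U (\pi_germ (mkpre hs hx)) <-> V x.
Proof.
split=> [oU s hs|h].
  have /sigT_openP/(_ (exist _ s (mem_set hs) : S)) : open (\pi_germ @^-1` U : set pregerm).
    exact: oU.
  move=> [V oV VE]; exists V => // x hx.
  by have := congr1 (fun P : set (germ_dom s) => P (exist _ x (mem_set hx))) VE => /= ->.
change (open (\pi_germ @^-1` U : set pregerm)); apply/sigT_openP => -[s hs0].
have [V oV VE] := h s (set_mem hs0); exists V => //.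
apply: seteq => -[x hx0].
have piE : (existT _ (exist _ s hs0 : S) (exist _ x hx0) : pregerm) =
   mkpre (set_mem hs0) (set_mem hx0).
  rewrite /mkpre (Prop_irrelevance (mem_set (set_mem hx0)) hx0).
  by move: (mem_set (set_mem hs0)) => hs1; rewrite (Prop_irrelevance hs1 hs0).
have := VE x (set_mem hx0); rewrite -piE; exact: iff_sym.
Qed.

(** the germs [s, x] with x in V *)
Definition slice s (V : set (chi C)) : set germ :=
  [set g | [/\ V (germ_src g), chi_at (germ_src g) s.`1 &
               same_germ (germ_elt g) s (germ_src g)]].

Lemma germ_pi s (hs : isg S s) x (hx : germ_dom s x) :
  germ_src (\pi_germ (mkpre hs hx)) = x /\
  same_germ (germ_elt (\pi_germ (mkpre hs hx))) s x.
Proof.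
by have := bracket_src (\pi_germ (mkpre hs hx)) hs hx; rewrite (bracketE _ hs hx).
Qed.

Lemma slice_pi s (hs : isg S s) V g : slice s V g ->
  exists (hx : germ_dom s (germ_src g)), g = \pi_germ (mkpre hs hx).
Proof.
move=> [_ xs sg]; have hx : germ_dom s (germ_src g) by split=> //; case: (germ_srcP g) => -[].
exists hx; apply/germ_eqP; have [-> h] := germ_pi hs hx; split=> //.
by apply: (same_germ_trans (germ_srcO g) sg); exact: same_germ_sym.
Qed.

Lemma pi_slice s (hs : isg S s) x (hx : germ_dom s x) (V : set (chi C)) :
  V x -> slice s V (\pi_germ (mkpre hs hx)).
Proof.
by move=> Vx; have [e h] := germ_pi hs hx; have [_ xs] := hx; split; rewrite e.
Qed.

Lemma slice_open s V : isg S s -> open V -> open (slice s V).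
Proof.
move=> hs oV; apply/germ_openP => t ht.
pose W A : set (chi C) := xget setT [set W' : set (chi C) | open W' /\
   forall x, Omega C x -> chi_at x A <-> W' x].
have WP A : Jbar C A -> open (W A) /\ forall x, Omega C x -> chi_at x A <-> W A x.
  move=> /chi_at_open[W' oW' hW']; rewrite /W; case: xgetP => [_ _ []//|].
  by move=> /(_ W') [].
exists (V `&` W s.`1 `&` \bigcup_(A in [set A | Jbar C A /\ restr t A = restr s A]) W A).
  apply: openI; last by apply: bigcup_open => A [/WP[]].
  by apply: openI => //; case: (WP _ (Jbar_dom (isgI hs))).
have [_ Ws] := WP _ (Jbar_dom (isgI hs)).
move=> x hx; have ox : Omega C x by have [[]] := hx.
have [e h] := germ_pi ht hx.
rewrite /slice /= e; split=> [[Vx xs hs']|[[Vx /Ws xs] [A [jA eA] xA]]].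
  split; first by split=> //; apply/Ws.
  have [A [jA xA eA]] := same_germ_trans ox (same_germ_sym h) hs'.
  by exists A => //; have [_ WA] := WP _ jA; apply/WA.
split=> //; first exact: xs.
apply: (same_germ_trans ox h); exists A; split=> //.
by have [_ WA] := WP _ jA; apply/WA.
Qed.

Lemma slice_nbhs g s (U : set germ) : isg S s -> chi_at (germ_src g) s.`1 ->
  same_germ (germ_elt g) s (germ_src g) -> nbhs g U ->
  exists V, [/\ open V, V (germ_src g) & slice s V `<=` U].
Proof.
move=> hs xs sg; rewrite nbhsE => -[U' [oU' U'g] U'U].
have /germ_openP/(_ s hs)[V oV VE] := oU'.
have sT : slice s setT g by [].
exists V; split=> //.
  by have [hx e] := slice_pi hs sT; apply/(VE _ hx); rewrite -e.
move=> h sh; apply: U'U; have [hx e] := slice_pi hs sh; rewrite e; apply/VE.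
by case: sh.
Qed.

Lemma nbhs_slice g s V : isg S s -> open V -> slice s V g -> nbhs g (slice s V).
Proof. by move=> hs oV sg; apply: open_nbhs_nbhs; split=> //; exact: slice_open. Qed.

Lemma slice_self g (V : set (chi C)) : V (germ_src g) -> slice (germ_elt g) V g.
Proof. by move=> Vg; split=> //; [exact: germ_src_at|exact: germ_refl]. Qed.

Lemma germ_slice s : isg S s ->
  [/\ open (slice s setT),
      {in slice s setT &, injective germ_src},
      germ_src @` slice s setT = germ_dom s &
      forall U, U `<=` slice s setT -> open U <->
        exists2 V, open V & germ_src @` U = germ_dom s `&` V].
Proof.
move=> hs.
have inj : {in slice s setT &, injective germ_src}.
  move=> g h /set_mem[_ _ sg] /set_mem[_ _ sh] e; apply/germ_eqP; split=> //.
  apply: (same_germ_trans (germ_srcO g) sg); rewrite e; exact: same_germ_sym.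
split=> //.
- by apply: slice_open => //; exact: openT.
- apply: seteq => x; split=> [[g sg <-]|hx]; first by have [] := slice_pi hs sg.
  exists (\pi_germ (mkpre hs hx)); first exact: pi_slice.
  by case: (germ_pi hs hx).
- move=> U Us; split=> [/germ_openP/(_ s hs)[V oV VE]|[V oV VE]].
    exists V => //; apply: seteq => x; split=> [[g Ug <-]|[hx Vx]].
      have [hx e] := slice_pi hs (Us _ Ug); split=> //.
      by apply/(VE _ hx); rewrite -e.
    by exists (\pi_germ (mkpre hs hx)); [exact/VE|case: (germ_pi hs hx)].
  suff -> : U = slice s V by exact: slice_open.
  apply: seteq => g; split=> [Ug|sg].
    have : (germ_dom s `&` V) (germ_src g) by rewrite -VE; exists g.
    by case: (Us _ Ug) => _ ? ? [_ ?].
  have sg' : slice s setT g by case: sg.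
  have : (germ_src @` U) (germ_src g).
    by rewrite VE; have [? _] := slice_pi hs sg; split=> //; case: sg.
  by move=> [h Uh /inj]; rewrite !inE => <- //; exact: Us.
Qed.

Lemma Jbar_imgI t A : Ilbar C t -> Jbar C A -> Jbar C (img t A).
Proof.
move=> ht jA; rewrite -(relVV t).
have [t' [d [ht' hd _ ->]]] := Ilbar_inv ht; rewrite img_restrV.
by apply: Jbar_setI => //; apply: Jbar_img => //; exact: Il_inv.
Qed.

Lemma same_germV s t x : Ilbar C s -> Ilbar C t -> Omega C x -> chi_at x t.`1 ->
  same_germ s t x -> same_germ s^-1 t^-1 (act t x).
Proof.
move=> hs ht ox xt [A [jA xA eA]].
have st a b : A a -> s (a, b) <-> t (a, b).
  move=> Aa; have e : (A a /\ s (a, b)) = (A a /\ t (a, b)).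
    exact: (congr1 (fun u : set (C * C) => u (a, b)) eA).
  split=> h; first by suff : A a /\ t (a, b); [case|rewrite -e].
  by suff : A a /\ s (a, b); [case|rewrite e].
have jt := Jbar_imgI ht jA.
exists (img t A); split=> //.
  apply/(chi_at_act ht ox xt jt).
  apply: (chi_atS ox _ _ (chi_atI ox xA xt)).
    by apply: Jbar_imgI => //; exact: Ilbar_inv.
  by move=> a [Aa [b tab]]; exists b => //; exists a.
have [_ is_] := pbij_Ilbar hs; have [_ it] := pbij_Ilbar ht.
apply: releqP => y z /=; split=> -[[a Aa tay] szy]; split; try by exists a.
  have sa : s (a, y) by exact/st.
  by have e : a = z by [exact: is_ sa szy]; subst a.
by have e : a = z by [exact: it tay szy]; subst a; exact/st.
Qed.

Lemma germ_inv_continuous : continuous (minv : germ -> germ).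
Proof.
move=> g U nU; have ie := germ_inv_elt g; have is_ := germ_inv_src g.
have hV : isg S (germ_elt g)^-1 by exact/isg_inv/germ_eltP.
have [||V [oV Vg sVU]] := @slice_nbhs (germ_inv g) (germ_elt g)^-1 U hV _ _ nU.
- by rewrite is_; case: (germ_rngP g).
- by rewrite is_.
have [p cp pE] := act_continuous (germ_eltI g).
have oW : open (p @^-1` V) by apply: open_comp => // x _; exact: cp.
have Wg : (p @^-1` V) (germ_src g).
  rewrite /= -pE; [by rewrite is_ in Vg|exact: germ_srcO|exact: germ_src_at].
apply: filterS (nbhs_slice (germ_eltP g) oW (slice_self Wg)).
move=> h /= [Vh hs hh]; apply: sVU.
have rE : germ_rng h = act (germ_elt g) (germ_src h).
  by apply: same_germ_act => //; [exact: germ_eltI|exact: germ_eltI|exact: germ_srcO].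
have {}Vh : V (act (germ_elt g) (germ_src h)) by rewrite pE//; exact: germ_srcO.
have := germ_inv_elt h; rewrite /slice /= (germ_inv_src h) => ih; split.
- by rewrite rE.
- rewrite rE; apply: chi_at_act_dom => //; [exact: germ_eltI|exact: germ_srcO].
- apply: (same_germ_trans (germ_rngO h) ih); rewrite rE.
  by apply: same_germV => //; [exact: germ_eltI|exact: germ_eltI|exact: germ_srcO].
Qed.

Lemma slice_mul s t g h : Ilbar C s -> Ilbar C t -> germ_src g = germ_rng h ->
  slice s setT g -> slice t setT h ->
  chi_at (germ_src h) (s \; t).`1 /\
  same_germ (germ_elt (germ_mul g h)) (s \; t) (germ_src h).
Proof.
move=> hs ht gh [_ xs sg] [_ xt th]; split; last exact: germ_mul_same.
apply: chi_at_comp => //; first exact: germ_srcO.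
rewrite -(same_germ_act (germ_eltI h) ht (germ_srcO h) th).
by move: xs; rewrite gh.
Qed.

Lemma germ_mul_continuous : {within [set gh : germ * germ | dom gh.1 = tgt gh.2],
  continuous (fun gh : germ * germ => mcomp gh.1 gh.2)}.
Proof.
apply/subspace_continuousP => -[g h] /= /germ_dtP gh U nU.
have [xst sgh] := slice_mul (germ_eltI g) (germ_eltI h) gh
   (slice_self (V := setT) I) (slice_self (V := setT) I).
have [|||V [oV Vg sVU]] :=
  @slice_nbhs (germ_mul g h) (germ_elt g \; germ_elt h) U _ _ _ nU.
- by case: (germ_mulP gh).
- by rewrite germ_mul_src.
- by rewrite germ_mul_src.
rewrite germ_mul_src// in Vg.
have Wgh : nbhs (g, h) (slice (germ_elt g) setT `*` slice (germ_elt h) V).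
  exists (slice (germ_elt g) setT, slice (germ_elt h) V) => //; split=> /=.
    apply: nbhs_slice; [exact: germ_eltP|exact: openT|exact: slice_self].
  by apply: nbhs_slice; [exact: germ_eltP| |exact: slice_self].
rewrite /nbhs /=; apply: filterS Wgh => -[g' h'] /= [sg' sh'] /germ_dtP gh'.
have sh'T : slice (germ_elt h) setT h' by case: sh'.
have [x' e'] := slice_mul (germ_eltI g) (germ_eltI h) gh' sg' sh'T.
apply: sVU; split; rewrite germ_mul_src//.
by case: sh'.
Qed.

Lemma slice_d s V g : Ilbar C s -> slice s V g -> slice (idrel s.`1) V (germ_d g).
Proof.
move=> hs [Vg xs sg]; split; rewrite germ_d_src//; first by rewrite dom_idrel.
apply: (same_germ_trans (germ_srcO g) (germ_d_elt g)).
by apply: same_germ_idrel => //; [exact: germ_srcO|exact: germ_src_at].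
Qed.

Lemma germ_d_continuous : continuous (dom : germ -> germ).
Proof.
move=> g U nU.
have [|||V [oV Vg sVU]] :=
  @slice_nbhs (germ_d g) (idrel (germ_elt g).`1) U _ _ _ nU.
- by case: (germ_d_ax g).
- by rewrite germ_d_src dom_idrel; exact: germ_src_at.
- by rewrite germ_d_src; exact: germ_d_elt.
rewrite germ_d_src in Vg.
apply: filterS (nbhs_slice (germ_eltP g) oV (slice_self Vg)) => h sh.
by apply: sVU; apply: slice_d => //; exact: germ_eltI.
Qed.

Lemma germ_d_open (U : set germ) : open U -> open ((dom : germ -> germ) @` U).
Proof.
move=> oU; rewrite openE => _ [g Ug <-].
have nU : nbhs g U by apply: open_nbhs_nbhs.
have [V [oV Vg sVU]] :=
  slice_nbhs (germ_eltP g) (germ_src_at g) (germ_refl g) nU.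
have [h1 h2 h3] := germ_d_ax g.
have gV : slice (idrel (germ_elt g).`1) V (germ_d g).
  by apply: slice_d; [exact: germ_eltI|exact: slice_self].
apply: filterS (nbhs_slice h1 oV gV) => u su.
have [Vu xu eu] := su; rewrite dom_idrel in xu.
have hx : germ_dom (germ_elt g) (germ_src u).
  by split=> //; case: (germ_srcP u) => -[].
have [e1 e2] := germ_pi (germ_eltP g) hx.
exists (\pi_germ (mkpre (germ_eltP g) hx)).
  by apply: sVU; exact: pi_slice.
apply/germ_eqP; rewrite [germ_src _]germ_d_src e1; split=> //.
apply: (same_germ_trans (germ_srcO u) _ (same_germ_sym eu)).
have := germ_d_elt (\pi_germ (mkpre (germ_eltP g) hx)); rewrite e1 => h.
apply: (same_germ_trans (germ_srcO u) h); apply: same_germ_idrel => //.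
  exact: germ_srcO.
by rewrite -[X in chi_at X]e1; exact: germ_src_at.
Qed.

Lemma germ_d_inj (g : germ) :
  exists2 U, open_nbhs g U & {in U &, injective (dom : germ -> germ)}.
Proof.
exists (slice (germ_elt g) setT).
  split; last exact: slice_self.
  by apply: slice_open; [exact: germ_eltP|exact: openT].
move=> h k hU kU /germ_ddP; have [_ inj _ _] := germ_slice (germ_eltP g).
exact: inj.
Qed.

HB.instance Definition _ := isEtale.Build germ germ_inv_continuous
  germ_mul_continuous germ_d_continuous germ_d_open germ_d_inj.

(** the germs [s, chi] with s in A *)
Definition germs_of (A : set (set (C * C))) : set germ :=
  [set \pi_germ p | p in [set p : pregerm | A (pg_elt p)]].

Lemma identitiesP g : identities germ g <->
  same_germ (germ_elt g) (idrel (germ_elt g).`1) (germ_src g).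
Proof.
split=> [e|e]; first by have := germ_d_elt g; rewrite [germ_d g]e.
apply/germ_eqP; rewrite [germ_src _]germ_d_src; split=> //.
exact: (same_germ_trans (germ_srcO g) (germ_d_elt g) (same_germ_sym e)).
Qed.

(** The identities are the germs of idempotents. *)
Lemma identitiesE : identities germ = germs_of [set s | exists A, s = idrel A].
Proof.
apply: seteq => g; split=> [e|[p [A eA] {g}<-]].
  exists (mkpre (isg_idV (germ_eltP g)) (germ_dom_idrel
    (germ_srcP g).1 (germ_srcP g).2)); first by eexists.
  apply/germ_eqP.
  have [-> h] := germ_pi (isg_idV (germ_eltP g)) (germ_dom_idrel
    (germ_srcP g).1 (germ_srcP g).2); split=> //.
  apply: (same_germ_trans (germ_srcO g) h); apply: same_germ_sym.
  exact/identitiesP.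
set g := \pi_germ p.
have gE : g = \pi_germ (mkpre (pg_eltP p) (pg_chiP p)).
  by apply/pi_eq; exact: germ_rel_refl.
have [e h] := germ_pi (pg_eltP p) (pg_chiP p); rewrite -gE in e h.
have [_ px] := pg_chiP p; rewrite -e in h px.
have ox := germ_srcO g; apply/identitiesP.
apply: (same_germ_trans ox h); rewrite eA; apply: same_germ_idrel => //.
  by move: px; rewrite eA dom_idrel.
exact: germ_src_at.
Qed.

Lemma germ_src_continuous : continuous germ_src.
Proof.
move=> g V; rewrite nbhsE => -[V' [oV' V'g] V'V].
apply: filterS (nbhs_slice (germ_eltP g) oV' (slice_self V'g)) => h [Vh _ _].
exact: V'V.
Qed.

Lemma germ_src_open (U : set germ) : open U ->
  exists2 V, open V & germ_src @` U = bOmega C `&` V.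
Proof.
move=> oU.
exists (\bigcup_(V in [set V | open V /\ bOmega C `&` V `<=` germ_src @` U]) V).
  by apply: bigcup_open => V [].
apply: seteq => x; split=> [[g Ug <-]|[bx [V [_ VU] Vx]]]; last exact: VU.
have [bx xg] := germ_srcP g; split=> //.
have nU : nbhs g U by apply: open_nbhs_nbhs.
have [V [oV Vg sVU]] :=
  slice_nbhs (germ_eltP g) (germ_src_at g) (germ_refl g) nU.
have [W oW WE] := chi_at_open (Jbar_dom (germ_eltI g)).
exists (V `&` W); last by split=> //; apply/WE => //; exact: germ_srcO.
split=> [|y [by_ [Vy Wy]]]; first exact: openI.
have hy : germ_dom (germ_elt g) y by split=> //; apply/WE => //; case: by_.
exists (\pi_germ (mkpre (germ_eltP g) hy)); last by case: (germ_pi (germ_eltP g) hy).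
by apply: sVU; exact: pi_slice.
Qed.

Lemma identities_open : open (identities germ).
Proof.
rewrite openE => g /identitiesP e.
have [h1 h2 h3] := germ_d_ax g.
have gT : slice (idrel (germ_elt g).`1) setT g by split=> //; rewrite dom_idrel.
apply: filterS (nbhs_slice h1 openT gT) => h [_ + hg].
rewrite dom_idrel => hx; apply/identitiesP.
apply: (same_germ_trans (germ_srcO h) hg); apply: same_germ_idrel => //.
  exact: germ_srcO.
exact: germ_src_at.
Qed.

(** The source map identifies the unit space with bOmega. *)
Lemma unit_space : Il C `<=` isg S ->
  [/\ set_bij (identities germ) (bOmega C) germ_src &
      forall U, U `<=` identities germ -> open U <->
        exists2 V, open V & germ_src @` U = bOmega C `&` V].
Proof.
move=> IlS.
have inj : {in identities germ &, injective germ_src}.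
  by move=> g h /set_mem gi /set_mem hi /germ_ddP; rewrite [germ_d g]gi [germ_d h]hi.
split.
  split=> //; first by move=> g _; case: (germ_srcP g).
  move=> x bx; have [[hx _] _] := bx; have [e xe] := Jhat_true hx.
  have [s hs es] := JP e.
  have hS : isg S (idrel s.`1) by apply/isg_idV/IlS.
  have hd : germ_dom (idrel s.`1) x.
    apply: germ_dom_idrel => //; rewrite -es; apply/chi_atJ => //.
    by case: bx.
  exists (\pi_germ (mkpre hS hd)); last by case: (germ_pi hS hd).
  by rewrite identitiesE; exists (mkpre hS hd) => //; eexists.
move=> U Ui; split=> [|[V oV VE]]; first exact: germ_src_open.
suff -> : U = identities germ `&` germ_src @^-1` V.
  apply: openI; first exact: identities_open.
  by apply: open_comp => // g _; exact: germ_src_continuous.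
apply: seteq => g; split=> [Ug|[gi Vg]].
  split; first exact: Ui.
  suff : (bOmega C `&` V) (germ_src g) by case.
  by rewrite -VE; exists g.
have [h Uh e] : (germ_src @` U) (germ_src g).
  by rewrite VE; split=> //; case: (germ_srcP g).
by rewrite -(inj h g)//; apply/mem_set => //; exact: Ui.
Qed.

End Germs.
Arguments germ {C} S.
Arguments germs_of {C} S A.

Section Inclusion.
Context {C : lcCategoryType}.
Local Notation G := (germ (Il_isg C)).
Local Notation Gbar := (germ (Ilbar_isg C)).

(** The morphism induced by the inclusion of Il in Ilbar *)
Definition germ_incl (g : G) : Gbar :=
  \pi_Gbar (@mkpre C (Ilbar_isg C) _ _ (germ_eltI g) (germ_srcP g)).

Lemma germ_inclP g : germ_src (germ_incl g) = germ_src g /\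
  same_germ (germ_elt (germ_incl g)) (germ_elt g) (germ_src g).
Proof. exact: (@germ_pi C (Ilbar_isg C)). Qed.

Lemma germ_incl_rng g : germ_rng (germ_incl g) = germ_rng g.
Proof.
have [e h] := germ_inclP g; rewrite /germ_rng e; apply: same_germ_act => //.
- exact: germ_eltI.
- exact: germ_eltI.
- exact: germ_srcO.
Qed.

Lemma germ_incl_slice s V g : slice s V g -> slice s V (germ_incl g).
Proof.
move=> [Vg xs sg]; have [e h] := germ_inclP g; split; rewrite e//.
exact: same_germ_trans (germ_srcO g) h sg.
Qed.

Lemma germ_incl_pi s (hs : Il C s) x (hx : germ_dom s x) :
  germ_incl (\pi_G (@mkpre C (Il_isg C) s x hs hx)) =
  \pi_Gbar (@mkpre C (Ilbar_isg C) s x (Il_Ilbar hs) hx).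
Proof.
set g := \pi_G _; have [e h] := germ_inclP g.
have [e1 h1] := @germ_pi C (Il_isg C) s hs x hx.
have [e2 h2] := @germ_pi C (Ilbar_isg C) s (Il_Ilbar hs) x hx.
apply/germ_eqP; rewrite e e1 e2; split=> //; rewrite e1 in h.
have ox : Omega C x by have [[]] := hx.
apply: (same_germ_trans ox h); apply: (same_germ_trans ox h1).
exact: same_germ_sym.
Qed.

Lemma germ_incl_bij : set_bij setT setT germ_incl.
Proof.
split=> //.
- move=> g h _ _ /germ_eqP[e s]; have [e1 h1] := germ_inclP g.
  have [e2 h2] := germ_inclP h; rewrite e1 e2 in e s.
  apply/germ_eqP; split=> //; have ox := germ_srcO g.
  apply: (same_germ_trans ox (same_germ_sym h1)); apply: (same_germ_trans ox s).
  by rewrite e.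
- move=> h _; have [t [d [ht jd td tE]]] := germ_eltI h.
  have hd : chi_at (germ_src h) d by rewrite -(dom_restr td) -tE; exact: germ_src_at.
  have hs : slice t setT h.
    split=> //; first by apply: (chi_atS (germ_srcO h) _ td hd); exact/Jbar_dom/Il_Ilbar.
    by exists d; split=> //; rewrite tE restr_restr setIid.
  have [hx e] := slice_pi (Il_Ilbar ht : isg (Ilbar_isg C) t) hs.
  exists (\pi_G (@mkpre C (Il_isg C) t _ ht hx)) => //.
  by rewrite germ_incl_pi [RHS]e.
Qed.

Lemma germ_incl_continuous : continuous germ_incl.
Proof.
move=> g U nU; have [e h] := germ_inclP g.
have [|||V [oV Vg sVU]] := @slice_nbhs C (Ilbar_isg C) _ (germ_elt g) U _ _ _ nU.
- exact: germ_eltI.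
- by rewrite e; exact: germ_src_at.
- by rewrite e.
rewrite e in Vg.
apply: filterS (nbhs_slice (germ_eltP g) oV (slice_self Vg)) => k sk.
by apply: sVU; exact: germ_incl_slice.
Qed.

Lemma germ_incl_open (U : set G) : open U -> open (germ_incl @` U).
Proof.
move=> oU; rewrite openE => _ [g Ug <-].
have nU : nbhs g U by apply: open_nbhs_nbhs.
have [V [oV Vg sVU]] :=
  slice_nbhs (germ_eltP g) (germ_src_at g) (germ_refl g) nU.
have hs : isg (Ilbar_isg C) (germ_elt g) by exact: germ_eltI.
apply: filterS (nbhs_slice hs oV (germ_incl_slice (slice_self Vg))) => k sk.
have [hx e] := slice_pi hs sk.
exists (\pi_G (@mkpre C (Il_isg C) _ _ (germ_eltP g) hx)).
  by apply: sVU; apply: pi_slice; case: sk.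
rewrite germ_incl_pi [RHS]e; congr (\pi_Gbar (mkpre _ _)); exact: Prop_irrelevance.
Qed.

Lemma germ_incl_dom g : germ_incl (dom g) = dom (germ_incl g).
Proof.
have [e1 h1] := germ_inclP g; have [e2 h2] := germ_inclP (dom g).
have [e3 h3] := (germ_d_src (germ_incl g), germ_d_elt (germ_incl g)).
have e4 : germ_src (dom g) = germ_src g := germ_d_src g.
apply/germ_eqP; rewrite e2 e4 [germ_src (dom _)]e3 e1; split=> //.
rewrite e4 in h2; rewrite e1 in h3; have ox := germ_srcO g.
apply: (same_germ_trans ox h2); apply: (same_germ_trans ox (germ_d_elt g)).
apply: (same_germ_trans ox _ (same_germ_sym h3)).
apply: same_germ_idrel => //; first exact: germ_src_at.
by rewrite -e1; exact: germ_src_at.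
Qed.

Lemma germ_incl_dtP g h : dom (germ_incl g) = tgt (germ_incl h) <-> dom g = tgt h.
Proof.
split=> /germ_dtP e; apply/germ_dtP; move: e;
  by rewrite (germ_inclP g).1 germ_incl_rng.
Qed.

Lemma germ_incl_mul g h : dom g = tgt h ->
  germ_incl (mcomp g h) = mcomp (germ_incl g) (germ_incl h).
Proof.
move=> gh; have gh' := gh; move/germ_dtP : gh => gh.
move/germ_incl_dtP/germ_dtP : gh' => gh'.
have [eg hg] := germ_inclP g; have [eh hh] := germ_inclP h.
have [em hm] := germ_inclP (mcomp g h).
have e4 : germ_src (mcomp g h) = germ_src h := germ_mul_src gh.
have e5 : germ_src (mcomp (germ_incl g) (germ_incl h)) = germ_src h.
  by rewrite [LHS](germ_mul_src gh').
apply/germ_eqP; rewrite em e4 e5; split=> //; rewrite e4 in hm.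
have ox := germ_srcO h.
apply: (same_germ_trans ox hm); apply: (same_germ_trans ox (germ_mul_elt gh)).
apply: same_germ_sym; rewrite -eh; apply: germ_mul_same => //.
- exact: germ_eltI.
- exact: germ_eltI.
- by rewrite eg.
- by rewrite eh.
Qed.

Lemma germ_incl_tgt g : germ_incl (tgt g) = tgt (germ_incl g).
Proof. by rewrite -dom_minv germ_incl_dom; apply/germ_incl_dtP; rewrite dom_minv. Qed.

(** An isomorphism of topological groupoids *)
Theorem germ_incl_iso :
  [/\ set_bij setT setT germ_incl,
      continuous germ_incl /\ (forall U, open U -> open (germ_incl @` U)),
      forall g, germ_incl (dom g) = dom (germ_incl g),
      forall g, germ_incl (tgt g) = tgt (germ_incl g) &
      forall g h, dom g = tgt h ->
        germ_incl (mcomp g h) = mcomp (germ_incl g) (germ_incl h)].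
Proof.
split; [exact: germ_incl_bij| |exact: germ_incl_dom|exact: germ_incl_tgt
       |exact: germ_incl_mul].
by split; [exact: germ_incl_continuous|exact: germ_incl_open].
Qed.

End Inclusion.

(* Main.v *)
Require Import Defs.
From mathcomp Require Import all_boot.
From mathcomp Require Import all_classical topology.

Set Implicit Arguments.
Unset Strict Implicit.
Unset Printing Implicit Defensive.

Local Open Scope classical_set_scope.
Local Open Scope relation_scope.
Local Open Scope quotient_scope.

(** Everything reduces to maximal characters, which are dense in bOmega and
    behave well: if x is maximal and x(A) = 1 for some A in Jbar, then x(e) = 1
    for some e in J contained in A ([Omega_max_below]), and if x(A) = 0, then
    x(e) = 1 for some e in J disjoint from A ([Omega_max_apart]). Conversely
    every nonempty e in J has a maximal character with value 1 at e
    ([Omega_max_exists]). So statements about nonempty elements of J, like those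
    in the definition of Ilbarc and in condition (iii), translate into
    statements about maximal characters. Density is exploited through the fact
    that the value at an element of Jbar is locally constant on Omega
    ([near_chi_at]).

    For the first assertion, let s be in Ilbarc and x a maximal character in its
    domain. If s.x and x were different, they would be separated by disjoint
    elements f and g of J, and a nonempty e in J contained in f and mapped by s
    into g would contradict the definition of Ilbarc. By density s fixes all of
    its domain in bOmega, so the open set of germs of s consists of isotropy
    ([Ilbarc_act]). In the other direction, an interior point of the isotropy is
    a germ [s, x] where s fixes its whole domain in bOmega, after restricting
    s to an element of Jbar that cuts out a small neighbourhood of x
    ([nbhs_chi_at]). A maximal character with value 1 at e is then fixed by s, so
    it has value 1 at both e and s(e), and these sets meet ([Ilbarc_fixed]).

    Given the first assertion, (i) for Ilbar and (ii) are the same statement, and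
    [germ_incl_iso] transports (i) between the two groupoids. The germ [s, x] is a
    unit when s is the identity on some A in Jbar with x(A) = 1. If all germs of
    s are units, the sets of characters given by such A cover the domain of s in
    bOmega, which is compact, and a finite subcover is the family required by
    (iii) ([fixed_cover_exists]). If (iii) holds, a character in the domain of s
    with value 0 at every member of the finite family could be replaced by a
    maximal one, which would yield a nonempty g in J disjoint from the whole
    family ([fixed_cover_meets]). *)

(** * Maximal characters *)

Section MaximalCharacters.
Context {C : lcCategoryType}.
Implicit Types (x y : chi C) (e f g : J C) (A B : set C).

Lemma Jhat_neq0 x e : Jhat x -> x e -> val e !=set0.
Proof. by move=> [_ _ x0] xe; apply/set0P/negP => /eqP /x0; rewrite xe. Qed.

Definition indicator (X : set (J C)) : chi C := fun e => `[< X e >].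

Lemma Jhat_principal e : val e !=set0 ->
  Jhat (indicator [set f | val e `<=` val f]).
Proof.
move=> [z ez]; split.
- by exists e; apply/asboolP.
- move=> a b c abc; apply/asboolP/andP => /= [ec|[/asboolP ea /asboolP eb] u eu].
    by split; apply/asboolP => u /ec; rewrite abc => -[].
  by rewrite abc; split; [exact: ea|exact: eb].
- by move=> f f0; apply/asboolP => /= /(_ _ ez); rewrite f0.
Qed.

Lemma Jhat_chain e (K : set (set (J C))) : total_on K subset -> K !=set0 ->
  (forall X, K X -> X e /\ Jhat (indicator X)) ->
  Jhat (indicator (\bigcup_(X in K) X)).
Proof.
move=> tK [X0 KX0] KJ; split.
- by exists e; apply/asboolP; exists X0 => //; case: (KJ _ KX0).
- move=> a b c abc; have closed X : K X -> X c <-> X a /\ X b.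
    move=> /KJ[_ [_ mlt _]]; have := mlt a b c abc; rewrite /indicator => mX.
    split=> [/asboolP|[/asboolP Xa /asboolP Xb]].
      by rewrite mX => /andP[/asboolP ? /asboolP ?].
    by apply/asboolP; rewrite mX Xa.
  apply/asboolP/andP => [[X KX /(closed _ KX)[Xa Xb]]|].
    by split; apply/asboolP; exists X.
  move=> [/asboolP[X KX Xa] /asboolP[Y KY Yb]].
  have [XY|YX] := tK _ _ KX KY; [exists Y|exists X] => //; apply/closed => //.
    by split=> //; exact: XY.
  by split=> //; exact: YX.
- move=> f f0; apply/asboolP => -[X /KJ[_ [_ _ nX]] Xf].
  by have /asboolPn := nX f f0.
Qed.

(** The filters on J containing e are stable under unions of nonempty chains,
    so Zorn's lemma extends the principal filter of e to a maximal one. *)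
Lemma Omega_max_exists e : val e !=set0 -> exists2 x : chi C, Omega_max x & x e.
Proof.
move=> e0.
(* The empty set is admitted because it is the union of the empty chain. *)
pose P (X : set (J C)) := X = set0 \/ X e /\ Jhat (indicator X).
have [K KP tK|X [PX Xmax]] := @Zorn_bigcup (J C) P.
  pose K' := [set X | K X /\ X !=set0].
  have KK' : \bigcup_(X in K) X = \bigcup_(X in K') X.
    apply: seteq => f; split=> [[X KX Xf]|[X [KX _] Xf]]; exists X => //.
    by split=> //; exists f.
  have [K'0|/set0P K'0] := eqVneq K' set0.
    by left; rewrite KK' K'0 bigcup_set0.
  right; rewrite KK'; have K'J X : K' X -> X e /\ Jhat (indicator X).
    by move=> [KX [f Xf]]; have [X0|] := KP _ KX; first by rewrite X0 in Xf.
  split; first by case: K'0 => X KX; exists X => //; case: (K'J _ KX).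
  by apply: (Jhat_chain (e := e)) => // X Y [KX _] [KY _]; exact: tK.
case: PX => [X0|[Xe JX]].
  have eP := Jhat_principal e0; exfalso.
  apply: (Xmax [set f | val e `<=` val f]); last by right; split.
  by rewrite X0; split=> // /(_ e); apply.
exists (indicator X); last exact/asboolP.
split=> // y Jy Xy; apply/funext => f.
have yE : indicator [set f | y f] = y by apply/funext => h; exact: asboolb.
have sub : X `<=` [set f | y f] by move=> h Xh; apply: Xy; exact/asboolP.
have bus : [set f | y f] `<=` X.
  apply: contrapT => nyX; apply: (Xmax [set f | y f]) => //.
  by right; rewrite yE; split=> //; exact: sub.
by rewrite -yE; apply: asbool_equiv_eq; split=> [/bus|/sub].
Qed.

Lemma Jhat_avoid x (F : set (set C)) e : Jhat x -> finite_set F -> x e ->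
  (forall A, F A -> exists2 g, x g & val g `&` A = set0) ->
  exists g, [/\ x g, val g `<=` val e & forall A, F A -> val g `&` A = set0].
Proof.
move=> hx /finite_seqP[r ->] xe; elim: r => [_|A r ih Fr].
  by exists e; split.
have [|g [xg ge gr]] := ih.
  by move=> B Br; apply: Fr; rewrite /= inE [B \in r]Br orbT.
have [|h xh hA] := Fr A; first by rewrite /= inE eqxx.
exists (Jand g h); split; first by rewrite Jhat_and// xg.
  by move=> z [/ge].
move=> B; rewrite /= inE => /orP[/eqP ->|Br]; first by rewrite -setIA hA setI0.
by rewrite (setIC (val g)) -setIA gr// setI0.
Qed.

(** A maximal character takes the value 0 at f only because it takes the value
    1 at some g disjoint from f; hence each set f removed from e in
    A = e minus the union of the f can be avoided inside J. This is what lets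
    conditions over J control what happens on Jbar. *)
Lemma Omega_max_below x A : Omega_max x -> chi_at x A ->
  exists2 e, x e & val e `<=` A.
Proof.
move=> mx [e [F [[finF _ ->] xe xF]]].
have [||g [xg ge gF]] := @Jhat_avoid x (val @` F) e mx.1 _ xe.
- exact: finite_image.
- by move=> _ [f Ff <-]; exact/max_disj/xF.
exists g => // z gz; split=> [|[f Ff fz]]; first exact: ge.
have /seteqP[/(_ z) + _] := gF _ (ex_intro2 _ _ f Ff erefl).
by apply; split.
Qed.

(** If A is e minus the union of the f in F, then x(A) = 0 because x(e) = 0, and
    then some g with x(g) = 1 misses e, or because x(f) = 1 for some f in F,
    which misses A. *)
Lemma Omega_max_apart x A : Omega_max x -> Jbar C A -> ~ chi_at x A ->
  exists2 e, x e & val e `&` A = set0.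
Proof.
move=> mx [e [F dA]] /(chi_atE (Omega_max_Omega mx) dA) nxA.
have [_ _ AE] := dA; have [xe|xe] := boolP (x e); last first.
  have [g xg ge] := max_disj mx xe; exists g => //; rewrite -subset0 AE.
  by move=> z [gz [ez _]]; rewrite -ge.
have [f Ff xf] : exists2 f, F f & x f.
  apply: contrapT => nF; apply: nxA; split=> // f Ff; apply/negP => xf.
  by apply: nF; exists f.
exists f => //; rewrite -subset0 AE => z [fz [_]]; apply.
by exists f.
Qed.

End MaximalCharacters.

(** * Topology of the space of characters *)

Section Topology.
Context {C : lcCategoryType}.
Implicit Types (x y : chi C) (e f g : J C) (A B : set C).

Lemma near_finite (T : topologicalType) (I : choiceType) (D : set I)
    (P : I -> T -> Prop) (t : T) : finite_set D ->
  (forall i, D i -> \forall u \near t, P i u) ->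
  \forall u \near t, forall i, D i -> P i u.
Proof.
move=> /finite_fsetP[X ->] nP.
by apply: filterS (@filter_bigI _ _ X P _ _ nP) => u uP i /uP.
Qed.

Lemma near_agree x (D : set (J C)) : finite_set D ->
  \forall y \near x, forall e, D e -> y e = x e.
Proof.
move=> finD; apply: near_finite finD _ => e _.
by apply: open_nbhs_nbhs; split=> //; exact: (open_coord e (x e)).
Qed.

(** On Omega, the value at an element of Jbar depends on finitely many
    coordinates, so it is locally constant. *)
Lemma near_chi_at x A : Omega C x -> Jbar C A ->
  \forall y \near x, Omega C y -> chi_at y A <-> chi_at x A.
Proof.
move=> ox [e [F dA]]; have [finF _ _] := dA.
have finD : finite_set (e |` F) by rewrite finite_setU; split.
apply: filterS (near_agree x finD) => y yx oy.
rewrite (chi_atE ox dA) (chi_atE oy dA).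
have ye : y e = x e by apply: yx; left.
have yF f : F f -> y f = x f by move=> Ff; apply: yx; right.
by rewrite ye; split=> -[xe xF]; split=> // f Ff; [rewrite -yF|rewrite yF]; auto.
Qed.

Lemma Omega_coord x e : Omega C x -> ~~ x e ->
  exists2 A, chi_at x A & forall y, Omega C y -> chi_at y A -> ~~ y e.
Proof.
move=> ox xe; have [hx _] := ox; have [e0 xe0] := Jhat_true hx.
have dA : is_diff (val e0 `\` val e) e0 [set Jand e0 e].
  split; first exact: finite_set1.
    by move=> _ -> z [].
  rewrite bigcup_set1; apply: seteq => z.
  by split=> -[e0z n]; split=> //; [case|move=> ez; apply: n].
exists (val e0 `\` val e).
  apply/(chi_atE ox dA); split=> // _ ->.
  by rewrite Jhat_and// (negPf xe) andbF.
move=> y oy /(chi_atE oy dA)[ye0 /(_ _ erefl)].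
by rewrite Jhat_and ?ye0//; case: oy.
Qed.

(** The sets of characters with value 1 at a given element of Jbar form a basis
    of the topology of Omega. *)
Lemma nbhs_chi_at x (V : set (chi C)) : Omega C x -> nbhs x V ->
  exists2 A, chi_at x A & forall y, Omega C y -> chi_at y A -> V y.
Proof.
move=> ox; have [hx _] := ox.
(* The sets W as in the conclusion form a filter; a filter that contains the
   neighbourhoods coming from each coordinate converges to x. *)
pose F : set_system (chi C) := [set W | exists2 A, chi_at x A &
  forall y, Omega C y -> chi_at y A -> W y].
have FF : Filter F.
  split.
  - by have [e xe] := Jhat_true hx; exists (val e) => //; apply/chi_atJ.
  - move=> W W' [A xA AW] [B xB BW']; exists (A `&` B); first exact: chi_atI.
    move=> y oy /(chi_atIP oy (chi_at_Jbar xA) (chi_at_Jbar xB))[yA yB].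
    by split; [exact: AW|exact: BW'].
  - by move=> W W' WW' [A xA AW]; exists A => // y oy /(AW _ oy)/WW'.
suff : F --> x by exact.
apply/cvg_sup => e W [_ [[B oB <-] Bx sB]]; apply: (filterS sB).
rewrite /= in Bx.
have [xe|xe] := boolP (x e).
  exists (val e); first exact/chi_atJ.
  by move=> y oy /chi_atJ => /(_ oy) ye; rewrite /= ye -xe.
have [A xA Ae] := Omega_coord ox xe; exists A => // y oy yA.
by rewrite /= (negPf (Ae _ oy yA)) -(negPf xe).
Qed.

Lemma closure_near x (S : set (chi C)) (P : chi C -> Prop) : closure S x ->
  (\forall y \near x, P y) -> exists2 y, S y & P y.
Proof. by move=> cx nP; have [y [Sy Py]] := cx _ nP; exists y. Qed.

Lemma bOmega_near x A (P : chi C -> Prop) : bOmega C x -> chi_at x A ->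
  (\forall y \near x, P y) ->
  exists y, [/\ Omega_max y, chi_at y A & P y].
Proof.
move=> [ox cx] xA nP.
have nA := near_chi_at ox (chi_at_Jbar xA).
have [y my [Py yA]] := closure_near cx (filterI nP nA).
by exists y; split=> //; apply/yA => //; exact: Omega_max_Omega.
Qed.

Lemma compact_chi (K : set (chi C)) : closed K -> compact K.
Proof.
move=> cK; have cT : compact [set x : chi C | forall e, [set: bool] (x e)].
  exact: (@tychonoff (J C) (fun=> bool) (fun=> setT) (fun=> bool_compact)).
exact: (subclosed_compact cK cT).
Qed.

(** Every condition that defines Omega and the value at A is a condition on
    finitely many coordinates once A forces some coordinate to be 1, so it
    passes to the closure in the compact space of all maps from J to bool.
    Hence the set of characters in bOmega with value 1 at A is compact. *)
Lemma closure_max_Omega A x : Jbar C A ->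
  closure [set y | Omega_max y /\ chi_at y A] x -> bOmega C x /\ chi_at x A.
Proof.
move=> jA cx.
have agree (D : set (J C)) : finite_set D ->
    exists y, [/\ Omega_max y, chi_at y A & forall e, D e -> y e = x e].
  move=> /(near_agree x) nD; have [y [my yA] yD] := closure_near cx nD.
  by exists y.
have [e0 [F dA]] := jA; have [finF _ _] := dA.
have ox : Omega C x.
  split; first split.
  - have [//|y [my yA yx]] := agree [set e0]; exists e0.
    have [+ _] := (chi_atE (Omega_max_Omega my) dA).1 yA.
    by rewrite yx.
  - move=> e f g gef; have [|y [my yA yx]] := agree [set e; f; g].
      by rewrite !finite_setU; do !split; exact: finite_set1.
    have [[_ mlt _] _] := my; rewrite -!yx; first exact: mlt.
    + by left; right.
    + by left; left.
    + by right.
  - move=> e e0'; have [//|y [my yA yx]] := agree [set e].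
    by rewrite -yx//; case: my => -[_ _ y0] _; exact: y0.
  - move=> e G finG eG; have [|y [my yA yx]] := agree (e |` G).
      by rewrite finite_setU; split.
    rewrite -yx; last by left.
    have [_ py] := Omega_max_Omega my; move=> /(py e G finG eG)[f Gf yf].
    by exists f => //; rewrite -yx//; right.
split; first split=> //.
  by apply: (closureS _ cx) => y [].
have [y [my yA] yx] := closure_near cx (near_chi_at ox jA).
by apply/yx => //; exact: Omega_max_Omega.
Qed.

Lemma chi_at_finite_subcover A (E : set (set C)) : Jbar C A -> E `<=` Jbar C ->
  (forall x, bOmega C x -> chi_at x A -> exists2 B, E B & chi_at x B) ->
  exists E', [/\ finite_set E', E' `<=` E &
    forall x, Omega_max x -> chi_at x A -> exists2 B, E' B & chi_at x B].
Proof.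
move=> jA jE EA.
pose M := [set x : chi C | Omega_max x /\ chi_at x A].
have cK : near_covering (closure M).
  by apply/compact_near_coveringP/compact_chi/closed_closure.
(* Near coverings are indexed by a filter; here it consists of the properties
   that hold for all large enough finite subfamilies of E. *)
pose fin := [set E' | finite_set E' /\ E' `<=` E].
pose F := filter_from fin (fun E' => [set E'' | fin E'' /\ E' `<=` E'']).
pose P E' x := Omega_max x -> exists2 B, E' B & chi_at x B.
have FF : Filter F.
  apply: filter_from_filter.
    by exists set0; split=> //; exact: finite_set0.
  move=> E1 E2 [fE1 E1E] [fE2 E2E]; exists (E1 `|` E2).
    by split; [rewrite finite_setU|move=> B [/E1E|/E2E]].
  by move=> E3 [fE3 EE]; split; split=> // B ?; apply: EE; [left|right].
have [x Kx|E' [fE' E'E] EP] := cK (set (set C)) F P FF.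
  have [bx xA] := closure_max_Omega jA Kx; have [B EB xB] := EA x bx xA.
  have [ox _] := bx; have finB : fin [set B].
    by split; [exact: finite_set1|move=> _ ->].
  exists ([set y | Omega C y -> chi_at y B <-> chi_at x B],
          [set E' | fin E' /\ [set B] `<=` E']).
    split=> /=; first exact: (near_chi_at ox (jE _ EB)).
    by exists [set B].
  move=> [y E'] /= [yB [_ BE']] my; exists B; first exact: BE'.
  by apply/yB => //; exact: Omega_max_Omega.
exists E'; split=> // x mx xA.
have E'P : fin E' /\ E' `<=` E' by split; [split|].
by apply: (EP E' E'P x _ mx); exact: subset_closure.
Qed.

End Topology.

(** * Fixed characters *)

Section FixedPoints.
Context {C : lcCategoryType}.
Implicit Types (x y : chi C) (e f g : J C) (s : set (C * C)) (A B : set C).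

Lemma J_img_Ilbar s e : Ilbar C s -> val e `<=` s.`1 ->
  exists f : J C, val f = img s (val e).
Proof.
move=> [t [d [ht hd td ->]]]; rewrite dom_restr// => ed; exists (Jimg ht e).
apply: seteq => y /=; split=> -[z ez].
  by exists z => //; split=> //; exact: ed.
by move=> [_ tz]; exists z.
Qed.

(** If s moves the maximal character x, then x and s.x are separated by disjoint
    f and g with x(f) = 1 and (s.x)(g) = 1. A set e in J below dom s, f and
    the preimage of g with x(e) = 1 is then nonempty and moved by s off
    itself. *)
Lemma Ilbarc_act_max s x : Ilbarc C s -> Omega_max x -> chi_at x s.`1 ->
  act s x = x.
Proof.
move=> [[hs _] sc] mx xs; have ox := Omega_max_Omega mx.
have msx := Omega_max_act hs mx xs.
apply: mx.2; first exact: msx.1.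
move=> f xf /=; apply: contrapT => /negP sxf.
have [g sxg gf] := max_disj msx sxf.
have xg : chi_at x (img s^-1 (val g)) by apply/asboolP.
have xA := chi_atI ox (chi_atI ox xs ((chi_atJ f ox).2 xf)) xg.
have [e xe eA] := Omega_max_below mx xA.
have es : val e `<=` s.`1 by move=> z /eA[[]].
have [z [ez [u eu suz]]] := sc e (Jhat_neq0 mx.1 xe) es.
have [[_ fz] _] := eA z ez.
have [_ [w gw suw]] := eA u eu.
have [fs _] := pbij_Ilbar hs.
have /seteqP[/(_ z) g0 _] := gf; apply: g0; split=> //.
by rewrite (fs _ _ _ suz suw).
Qed.

(** Whether s.x and x differ at f is decided by values of x on Jbar, which are
    shared by a maximal character close to x. *)
Lemma Ilbarc_act s x : Ilbarc C s -> bOmega C x -> chi_at x s.`1 ->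
  act s x = x.
Proof.
move=> sc bx xs; apply/funext => f; have [[hs _] _] := sc.
have jA : Jbar C (img s^-1 (val f)).
  by apply: Jbar_imgI; [exact: Ilbar_inv|exact: J_Jbar].
have [ox _] := bx.
have nf := near_chi_at ox (J_Jbar f).
have [y [my ys [yA yf]]] := bOmega_near bx xs (filterI (near_chi_at ox jA) nf).
have oy := Omega_max_Omega my.
rewrite -[RHS]asboolb; apply: asbool_equiv_eq.
rewrite -(yA oy) -(chi_atJ f ox) -(yf oy) (chi_atJ f oy).
have /(congr1 (fun z : chi C => z f)) := Ilbarc_act_max sc my ys.
rewrite /act => <-; split; last by move/asboolP.
by move=> ?; apply/asboolP.
Qed.

(** A maximal character with value 1 at e, if fixed by s, has value 1 at both e
    and s(e), which therefore meet. *)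
Lemma Ilbarc_fixed s : Ilbar C s -> (exists2 x, bOmega C x & chi_at x s.`1) ->
  (forall y, Omega_max y -> chi_at y s.`1 -> act s y = y) -> Ilbarc C s.
Proof.
move=> hs [x bx xs] fixs; split; first split=> //.
  have [y [my ys _]] := bOmega_near bx xs filterT.
  have [e ye es] := Omega_max_below my ys.
  by exists e => //; exact: Jhat_neq0 my.1 ye.
move=> e e0 es; have [y my ye] := Omega_max_exists e0.
have oy := Omega_max_Omega my.
have ys : chi_at y s.`1.
  by apply: (chi_atS oy (Jbar_dom hs) es); exact/chi_atJ.
have [f fE] := J_img_Ilbar hs es.
have yf : y f.
  rewrite -(fixs y my ys); apply/asboolP.
  apply: (@chi_atS _ y (val e)) => //.
  - by apply: Jbar_imgI; [exact: Ilbar_inv|exact: J_Jbar].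
  - move=> z ez; have [u szu] := es _ ez.
    by exists u => //; rewrite fE; exists z.
  - exact/chi_atJ.
have yef : y (Jand e f) by rewrite Jhat_and ?ye//; exact: my.1.
by have := Jhat_neq0 my.1 yef; rewrite /= fE.
Qed.

End FixedPoints.

(** * Interior of the isotropy *)

Section Germs.
Context {C : lcCategoryType}.

Lemma isotropyP (S : invSemigroup C) (g : germ S) :
  isotropy (germ S) g <-> germ_rng g = germ_src g.
Proof. by split=> [/germ_dtP|e]; [|apply/germ_dtP]. Qed.

Lemma identities_interior (S : invSemigroup C) :
  identities (germ S) `<=` (isotropy (germ S))°.
Proof.
rewrite -open_subsetE; last exact: identities_open.
move=> g e; rewrite /isotropy /=; apply: esym.
by rewrite -[in LHS](e : dom g = g) tgt_dom.
Qed.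

Local Notation Gbar := (germ (Ilbar_isg C)).

(** If a neighbourhood of [s, x] consists of isotropy, restricting s to a small
    enough element of Jbar makes s fix all maximal characters in its domain,
    without changing the germ. Conversely the germs of a given s form an open
    set, which is made of isotropy when s is in Ilbarc. *)
Lemma interior_isotropy :
  (isotropy Gbar)° = germs_of (Ilbar_isg C) (Ilbarc C).
Proof.
apply: seteq => g; split=> [ig|[p pc <-]].
  have hs := germ_eltI g; set s := germ_elt g in hs.
  have [V [oV Vg sVI]] :=
    slice_nbhs (germ_eltP g) (germ_src_at g) (germ_refl g) ig.
  have ox := germ_srcO g.
  have [bx xs] := germ_srcP g.
  have nV : nbhs (germ_src g) V by exact: open_nbhs_nbhs.
  have [A xA AV] := nbhs_chi_at ox nV.
  have xsA := chi_atI ox xs xA.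
  pose t := restr s (s.`1 `&` A).
  have td : t.`1 = s.`1 `&` A by rewrite dom_restr// => z [].
  have ht : Ilbar C t.
    rewrite /t -comp_idrel; apply: Ilbar_comp => //.
    exact/Ilbar_idrel/(chi_at_Jbar xsA).
  have hx : germ_dom t (germ_src g) by split=> //; rewrite td.
  exists (mkpre (ht : isg (Ilbar_isg C) t) hx); last first.
    apply/esym/germ_eqP; have [e h] := germ_pi (ht : isg (Ilbar_isg C) t) hx.
    rewrite e; split=> //; apply: (same_germ_trans ox _ (same_germ_sym h)).
    exists (s.`1 `&` A); split=> //; first exact: chi_at_Jbar xsA.
    by rewrite /t restr_restr setIid.
  apply: Ilbarc_fixed => //; first by exists (germ_src g) => //; rewrite td.
  move=> y my; have oy := Omega_max_Omega my; rewrite td => ysA.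
  rewrite (act_eq_restr hs oy ysA).
  have [ys yA] := (chi_atIP oy (Jbar_dom hs) (chi_at_Jbar xA)).1 ysA.
  have hy : germ_dom s y by split=> //; split=> //; exact: subset_closure.
  have /isotropyP : isotropy Gbar (\pi_Gbar (mkpre (germ_eltP g) hy)).
    by apply: sVI; apply: pi_slice; exact: AV.
  have [e h] := germ_pi (germ_eltP g) hy.
  rewrite e => fy; apply: (etrans _ fy); rewrite /germ_rng e.
  by apply: same_germ_act => //; [exact: germ_eltI|exact: same_germ_sym].
have [[hs _] _] := pc.
suff sI : slice (pg_elt p) setT `<=` (isotropy Gbar)°.
  apply: sI; have -> : \pi_Gbar p = \pi_Gbar (mkpre (pg_eltP p) (pg_chiP p)).
    by apply/pi_eq; exact: germ_rel_refl.
  exact: pi_slice.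
rewrite -open_subsetE; last by apply: slice_open; [exact: pg_eltP|exact: openT].
move=> h [_ xs sg]; apply/isotropyP.
rewrite -[RHS](Ilbarc_act pc _ xs); last by case: (germ_srcP h).
by apply: same_germ_act => //; [exact: germ_eltI|exact: germ_srcO].
Qed.

Lemma image_interior (T U : topologicalType) (h : T -> U) (A : set U) :
  continuous h -> (forall W, open W -> open (h @` W)) -> set_surj setT setT h ->
  A° = h @` (h @^-1` A)°.
Proof.
move=> ch oh sh; apply: seteq => y; split.
  have [x _ <-] := sh y I; rewrite /interior nbhsE => -[W [oW Wx WA]].
  exists x => //; rewrite nbhsE; exists (h @^-1` W).
    by split=> //; apply: open_comp => // z _; exact: ch.
  by move=> z /WA.
move=> [x]; rewrite /interior nbhsE => -[W [oW Wx] WA] <-.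
rewrite nbhsE; exists (h @` W); first by split; [exact: oh|exists x].
by move=> _ [z /WA ? <-].
Qed.

(** The isomorphism [germ_incl] identifies the two isotropy subgroupoids, their
    interiors and the two unit spaces. *)
Lemma effective_incl :
  effective (germ (Il_isg C)) <-> effective Gbar.
Proof.
have [[_ inj surj] [ci oi] di ti mi] := @germ_incl_iso C.
rewrite /effective (image_interior _ ci oi surj).
have -> : germ_incl @^-1` isotropy Gbar = isotropy (germ (Il_isg C)).
  apply: seteq => g; rewrite /isotropy /= -di -ti; split=> [|-> //].
  by move/inj; rewrite !inE; apply.
have -> : identities Gbar = germ_incl @` identities (germ (Il_isg C)).
  apply: seteq => g; split=> [gi|[h hi <-]]; last first.
    by rewrite /identities /= -di hi.
  have [h _ hg] := surj g I; exists h => //.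
  by apply: inj; rewrite ?inE// di hg.
split=> [-> //|e]; apply: seteq => g; split=> gi.
  have [h hi /inj <-] :
      (germ_incl @` identities (germ (Il_isg C))) (germ_incl g).
    by rewrite -e; exists g.
  + by [].
  + by rewrite inE.
  + by rewrite inE.
exact: identities_interior.
Qed.

End Germs.

(** * Triviality of the germs of Ilbarc *)

Section Criterion.
Context {C : lcCategoryType}.
Local Notation Gbar := (germ (Ilbar_isg C)).

Definition fixed_cover (s : set (C * C)) (E : set (set C)) : Prop :=
  [/\ finite_set E,
      E `<=` Jbar C,
      forall eps, E eps -> restr s eps = idrel eps &
      forall g : J C, val g !=set0 -> val g `<=` s.`1 ->
        exists2 eps, E eps & (val g `&` eps) !=set0].

Lemma germ_identityP s x (hs : Ilbar C s) (hx : germ_dom s x) :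
  identities Gbar (\pi_Gbar (mkpre (hs : isg (Ilbar_isg C) s) hx)) <->
  exists A, [/\ Jbar C A, chi_at x A & restr s A = idrel A].
Proof.
set g := \pi_Gbar _.
have [ex eg] : germ_src g = x /\ same_germ (germ_elt g) s x.
  exact: germ_pi.
have [[ox _] xs] := hx.
have xg : chi_at x (germ_elt g).`1.
  by rewrite -[X in chi_at X]ex; exact: germ_src_at.
rewrite identitiesP ex; split=> [gi|[A [jA xA sA]]].
  have [A [jA xA sA]] := same_germ_trans ox (same_germ_sym eg) gi.
  have xAg := chi_atI ox xA xg.
  exists (A `&` (germ_elt g).`1); split=> //; first exact: chi_at_Jbar xAg.
  rewrite -restr_restr sA; apply: releqP => a b /=.
  by split=> [[gb [Aa [_ ba]]]|[[Aa ga] ba]].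
apply: (same_germ_trans ox eg); apply: (@same_germ_trans _ (idrel A)) => //.
  exists A; split=> //; rewrite sA; apply: releqP => a b /=.
  by split=> [[Aa ba]|[Aa []]].
exact: same_germ_idrel.
Qed.

(** Every x in bOmega with value 1 at dom s has value 1 at some A on which s is
    the identity, because [s, x] is a unit; compactness leaves finitely many
    such A. *)
Lemma fixed_cover_exists s :
  germs_of (Ilbar_isg C) (Ilbarc C) = identities Gbar ->
  Ilbarc C s -> exists E, fixed_cover s E.
Proof.
move=> triv sc; have [[hs _] _] := sc; have js := Jbar_dom hs.
pose D := [set A | Jbar C A /\ restr s A = idrel A].
have [||E [finE ED EP]] := @chi_at_finite_subcover C s.`1 D js.
- by move=> A [].
- move=> x bx xs; have hx : germ_dom s x by [].
  have : identities Gbar (\pi_Gbar (mkpre (hs : isg (Ilbar_isg C) s) hx)).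
    by rewrite -triv; exists (mkpre (hs : isg (Ilbar_isg C) s) hx).
  by move=> /germ_identityP[A [jA xA sA]]; exists A.
exists E; split=> //; try by move=> A /ED[].
move=> g g0 gs; have [x mx xg] := Omega_max_exists g0.
have ox := Omega_max_Omega mx; have xg' := (chi_atJ g ox).2 xg.
have [A EA xA] := EP x mx (chi_atS ox js gs xg').
exists A => //; have [e xe eA] := Omega_max_below mx (chi_atI ox xg' xA).
by have [z ez] := Jhat_neq0 mx.1 xe; exists z; exact: eA.
Qed.

(** Otherwise x has value 0 at the finitely many elements of E, and so does a
    maximal character y close to x. For a maximal character this produces a
    nonempty g in J below dom s that misses every element of E. *)
Lemma fixed_cover_meets s E x : Ilbar C s -> fixed_cover s E -> bOmega C x ->
  chi_at x s.`1 -> exists2 A, E A & chi_at x A.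
Proof.
move=> hs [finE jE _ Es] bx xs; have [ox _] := bx; apply: contrapT => nE.
have nearE : \forall y \near x, forall A, E A ->
    Omega C y -> chi_at y A <-> chi_at x A.
  by apply: near_finite finE _ => A /jE; exact: near_chi_at.
have [y [my ys yE]] := bOmega_near bx xs nearE.
have oy := Omega_max_Omega my; have [e ye es] := Omega_max_below my ys.
have [A EA|g [yg ge gE]] := Jhat_avoid my.1 finE ye.
  apply: Omega_max_apart my (jE _ EA) _ => /(yE _ EA oy) xA.
  by apply: nE; exists A.
have [A EA [z gAz]] := Es g (Jhat_neq0 my.1 yg) (subset_trans ge es).
by have /seteqP[/(_ z) + _] := gE A EA; apply.
Qed.

(** The unit space is always an open part of the isotropy, hence made of germs
    of Ilbarc; the covers give the other inclusion. *)
Lemma germs_of_Ilbarc_identities :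
  (forall s, Ilbarc C s -> exists E, fixed_cover s E) ->
  germs_of (Ilbar_isg C) (Ilbarc C) = identities Gbar.
Proof.
move=> cov; apply/seteqP; split; last first.
  by rewrite -interior_isotropy; exact: identities_interior.
move=> _ [p pc <-]; have [E Ecov] := cov _ pc; have [[hs _] _] := pc.
have -> : \pi_Gbar p = \pi_Gbar (mkpre (hs : isg (Ilbar_isg C) _) (pg_chiP p)).
  by apply/pi_eq; exact: germ_rel_refl.
apply/germ_identityP; have [bx xs] := pg_chiP p.
have [A EA xA] := fixed_cover_meets hs Ecov bx xs.
by have [_ jE sE _] := Ecov; exists A; split; [exact: jE| |exact: sE].
Qed.

End Criterion.

(* The first two entries of the list are the two readings of (i), one for each
   of the groupoids identified by germ_incl_iso. *)
Theorem theorem5p18 (C : lcCategoryType) :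
  (isotropy (germ (Ilbar_isg C)))° = germs_of (Ilbar_isg C) (Ilbarc C) /\
  [<-> effective (germ (Il_isg C));
       effective (germ (Ilbar_isg C));
       germs_of (Ilbar_isg C) (Ilbarc C) = identities (germ (Ilbar_isg C));
       forall s : set (C * C), Ilbarc C s ->
         exists E : set (set C),
           [/\ finite_set E,
               E `<=` Jbar C,
               forall eps, E eps -> restr s eps = idrel eps &
               forall g : J C, val g !=set0 -> val g `<=` s.`1 ->
                 exists2 eps, E eps & (val g `&` eps) !=set0]].
Proof.
split; first exact: interior_isotropy.
tfae.
- by move/effective_incl.
- by rewrite /effective interior_isotropy.
- by move=> triv s; exact: fixed_cover_exists.
- move=> cov; apply/effective_incl; rewrite /effective interior_isotropy.
  exact: germs_of_Ilbarc_identities.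
Qed.
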